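(* Let $\nu\ge2$ be an even integer, and suppose that $(z_0,p_0)\in M\times P$ is an ambiently transverse contact of order $\nu$ (defined in the context). Then the following hold after restricting to sufficiently small neighbourhoods of $(z_0,p_0)$ and $p_0$. 1. The selected incidence branch $\mathcal I_\nu=\{(z,p):\mathcal J_\nu(z,p)=0\}$ is a smooth submanifold of $M\times P$ of codimension $\nu$. 2. The parameter projection $\pi_P:\mathcal I_\nu\to P$ is locally an embedding. Its image $\mathcal G_\nu=\pi_P(\mathcal I_\nu)$ is therefore a smooth embedded submanifold germ of $P$, and $\operatorname{codim}_P\mathcal G_\nu=\nu-2$. In particular, each $p\in\mathcal G_\nu$ close to $p_0$ has a unique order-$\nu$ contact $z=z(p)$ on this selected local incidence branch, and $z(p)$ is smooth.
   Context: $M$ is a smooth surface, $P\subset\mathbb R^m$ is open, and $(X_p,h_p)$ is a smooth parameter family ($p\in P$) consisting of a vector field $X_p$ on $M$ and a switching function $h_p:M\to\mathbb R$. Write $H_k(z,p)=L_{X_p}^kh_p(z)$, $k\ge0$ (iterated Lie derivatives), and define $\mathcal J_\nu:M\times P\to\mathbb R^\nu$, $\mathcal J_\nu(z,p)=(H_0(z,p),\dots,H_{\nu-1}(z,p))$. A point $(z_0,p_0)$ is an ambiently transverse contact of order $\nu$ if $\mathcal J_\nu(z_0,p_0)=0$, $H_\nu(z_0,p_0)\ne0$, $\operatorname{rank}D_{(z,p)}\mathcal J_\nu(z_0,p_0)=\nu$, $X_{p_0}(z_0)\ne0$, and $d_zh_{p_0}(z_0)\ne0$. $\pi_P$ is the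 restriction of the projection $M\times P\to P$. *)

(* Defs.v *)
From HB Require Import structures.
From mathcomp Require Import all_boot all_order all_algebra.
From mathcomp Require Import all_classical all_reals all_analysis.

Set Implicit Arguments.
Unset Strict Implicit.
Unset Printing Implicit Defensive.
Import Order.TTheory GRing.Theory Num.Theory.
Import numFieldNormedType.Exports.

Local Open Scope classical_set_scope.
Local Open Scope ring_scope.

(* C^k and C^oo maps on an open set [U] of a finite-dimensional normed space.
   In finite dimension, C^(k+1) means differentiable with all directional
   derivatives of class C^k. *)
Fixpoint Ck_on (R : realType) (E F : normedModType R) (k : nat)
    (U : set E) (f : E -> F) : Prop :=
  match k with
  | 0 => forall x, U x -> {for x, continuous f}
  | k'.+1 => (forall x, U x -> differentiable f x) /\
             (forall v, Ck_on k' U (fun x => 'D_v f x))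
  end.

Definition smooth_on (R : realType) (E F : normedModType R)
  (U : set E) (f : E -> F) : Prop := forall k, Ck_on k U f.

(* A chart is a homeomorphism from the open set [cdom] of [T] onto the open set
   [cimg] of the model space [E]; [cmap] and [cinv] are total functions whose
   values outside [cdom] and [cimg] are irrelevant. *)
Record chart (R : realType) (T : topologicalType) (E : normedModType R) := Chart {
  cdom : set T;
  cimg : set E;
  cmap :> T -> E;
  cinv : E -> T;
  cdom_open : open cdom;
  cimg_open : open cimg;
  cmap_img : forall x, cdom x -> cimg (cmap x);
  cinv_dom : forall e, cimg e -> cdom (cinv e);
  cmapK : forall x, cdom x -> cinv (cmap x) = x;
  cinvK : forall e, cimg e -> cmap (cinv e) = e;
  cmap_cont : forall x, cdom x -> {for x, continuous cmap};
  cinv_cont : forall e, cimg e -> {for e, continuous cinv}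
}.

(* A smooth atlas with a distinguished chart around each point.  Any smooth
   atlas contains (up to repetition) such a family, which generates the same
   maximal atlas.  The chart [chart_at x] identifies the tangent space at [x]
   with [E]. *)
Record smooth_atlas (R : realType) (T : topologicalType) (E : normedModType R) :=
  SmoothAtlas {
    chart_at : T -> chart T E;
    chart_at_mem : forall x, cdom (chart_at x) x;
    chart_at_compat : forall x y,
      smooth_on [set e | cimg (chart_at x) e /\
                         cdom (chart_at y) (cinv (chart_at x) e)]
                (chart_at y \o cinv (chart_at x))
  }.

Record smooth_surface (R : realType) := SmoothSurface {
  surf_carrier :> topologicalType;
  surf_hausdorff : hausdorff_space surf_carrier;
  surf_second_countable : @second_countable surf_carrier;
  surf_atlas : smooth_atlas surf_carrier 'rV[R]_2
}.

Section CkTheory.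
Context (R : realType).
Implicit Types E F : normedModType R.

Lemma near_eq_differentiable E F (f g : E -> F) (x : E) :
  (\near x, f x = g x) -> differentiable f x -> differentiable g x.
Proof.
move=> fg /diff_locallyP[df dfE].
have gx : g x = f x by rewrite (nbhs_singleton fg).
have dgE : g \o shift x = cst (g x) + 'd f x +o_ 0 id.
  have fg0 : \forall y \near (0 : E), f (y + x) = g (y + x).
    by have := fg; rewrite (near_shift 0 x) subr0.
  move/eqaddoP: dfE => dfE; apply/eqaddoP => e e0.
  near=> y; rewrite !fctE /= gx -(near fg0 y)//.
  by near: y; exact: dfE.
have dE : 'd g x = 'd f x :> (E -> F) by exact: diff_unique.
by apply/diff_locallyP; rewrite dE.
Unshelve. all: by end_near. Qed.

Lemma Ck_on_ext E F k (U : set E) (f g : E -> F) : open U ->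
  (forall x, U x -> f x = g x) -> Ck_on k U f -> Ck_on k U g.
Proof.
move=> oU; elim: k f g => [|k IH] f g fg /=.
  move=> cf x Ux; rewrite /prop_for /continuous_at -fg//.
  apply: cvg_trans (cf x Ux); apply: near_eq_cvg.
  by near=> y; apply: fg; near: y; exact: open_nbhs_nbhs.
move=> [df Df]; have nfg x : U x -> \forall y \near x, f y = g y.
  by move=> Ux; near=> y; apply: fg; near: y; exact: open_nbhs_nbhs.
split=> [x Ux|v]; first exact: near_eq_differentiable (nfg x Ux) (df x Ux).
by apply: IH (Df v) => x Ux; exact/near_eq_derive/nfg.
Unshelve. all: by end_near. Qed.

Lemma Ck_on_cst E F k (U : set E) (a : F) : Ck_on k U (fun=> a).
Proof.
elim: k a => [|k IH] a /=; first by move=> x _; exact: cvg_cst.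
split=> [x _|v]; first exact: differentiable_cst.
rewrite (_ : (fun x => 'D_v (fun=> a) x) = fun=> 0) //.
by apply/funext => x; exact: derive_cst.
Qed.

Lemma smooth_on_id E (U : set E) : smooth_on U (@id E).
Proof.
case=> [|k] /=; first by move=> x _; exact: cvg_id.
split=> [x _|v]; first exact: ex_diff.
rewrite (_ : (fun x => 'D_v id x) = fun=> v); first exact: Ck_on_cst.
by apply/funext => x; exact: derive_id.
Qed.

Lemma smooth_on_ext E F (U : set E) (f g : E -> F) : open U ->
  (forall x, U x -> f x = g x) -> smooth_on U f -> smooth_on U g.
Proof. by move=> oU fg sf k; apply: Ck_on_ext (sf k). Qed.

End CkTheory.

Lemma open_setX (S T : topologicalType) (U : set S) (V : set T) :
  open U -> open V -> open (U `*` V).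
Proof.
rewrite !openE => oU oV [x y] [/= Ux Vy].
by exists (U, V) => //=; split; [exact: oU|exact: oV].
Qed.

Lemma continuous_map_pair (S S' T T' : topologicalType) (f : S -> T)
    (g : S' -> T') (x : S) (y : S') :
  {for x, continuous f} -> {for y, continuous g} ->
  {for (x, y), continuous (fun z => (f z.1, g z.2))}.
Proof.
move=> cf cg; apply: cvg_pair => /=.
  exact: (@cvg_comp _ _ _ fst f (nbhs (x, y)) (nbhs x) _ cvg_fst cf).
exact: (@cvg_comp _ _ _ snd g (nbhs (x, y)) (nbhs y) _ cvg_snd cg).
Qed.

Section CkProd.
Context (R : realType) (E E' F F' : normedModType R).

Lemma differentiable_map_pair (f : E -> F) (g : E' -> F') (z : E * E') :
  differentiable f z.1 -> differentiable g z.2 ->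
  differentiable (fun z => (f z.1, g z.2)) z /\
  forall v, 'D_v (fun z => (f z.1, g z.2)) z = ('D_v.1 f z.1, 'D_v.2 g z.2).
Proof.
move=> df dg.
have c1 : continuous (fst : E * E' -> E) by move=> ?; exact: cvg_fst.
have c2 : continuous (snd : E * E' -> E') by move=> ?; exact: cvg_snd.
have d1 : differentiable (fst : E * E' -> E) z.
  exact: (linear_differentiable (f := fst)).
have d2 : differentiable (snd : E * E' -> E') z.
  exact: (linear_differentiable (f := snd)).
have D1 : differentiable (f \o fst) z by exact: differentiable_comp.
have D2 : differentiable (g \o snd) z by exact: differentiable_comp.
have D : differentiable (fun z => (f z.1, g z.2)) z.
  exact: (differentiable_pair D1 D2).
split=> // v; rewrite deriveE// (diff_pair D1 D2) !deriveE//.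
rewrite (diff_comp d1 df) (diff_comp d2 dg) /=.
by rewrite (diff_lin (f := fst))// (diff_lin (f := snd)).
Qed.

Lemma smooth_on_map_pair (U : set E) (V : set E') (f : E -> F) (g : E' -> F') :
  open (U `*` V) -> smooth_on U f -> smooth_on V g ->
  smooth_on (U `*` V) (fun z => (f z.1, g z.2)).
Proof.
move=> oUV sf sg k; move: (sf k) (sg k) => {sf sg}.
elim: k f g => [|k IH] f g /= cf cg.
  move=> [x y] [/= Ux Vy].
  exact: continuous_map_pair (cf x Ux) (cg y Vy).
case: cf cg => df Df [dg Dg]; split=> [z [Uz Vz]|v].
  by have [] := differentiable_map_pair (df _ Uz) (dg _ Vz).
apply: Ck_on_ext (IH _ _ (Df v.1) (Dg v.2)) => // z [Uz Vz].
by have [_ ->] := differentiable_map_pair (df _ Uz) (dg _ Vz).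
Qed.

End CkProd.
Section ProductAtlas.
Context (R : realType) (T T' : topologicalType) (E E' : normedModType R).

Section ProductChart.
Context (c : chart T E) (d : chart T' E').

Let pdom : set (T * T') := cdom c `*` cdom d.
Let pimg : set (E * E') := cimg c `*` cimg d.
Let pmap (z : T * T') : E * E' := (c z.1, d z.2).
Let pinv (e : E * E') : T * T' := (cinv c e.1, cinv d e.2).

Let pdom_open : open pdom.
Proof. by apply: open_setX; exact: cdom_open. Qed.

Let pimg_open : open pimg.
Proof. by apply: open_setX; exact: cimg_open. Qed.

Let pmap_img z : pdom z -> pimg (pmap z).
Proof. by case=> ? ?; split; exact: cmap_img. Qed.

Let pinv_dom e : pimg e -> pdom (pinv e).
Proof. by case=> ? ?; split; exact: cinv_dom. Qed.

Let pmapK z : pdom z -> pinv (pmap z) = z.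
Proof. by case: z => ? ? [] *; rewrite /pinv !cmapK. Qed.

Let pinvK e : pimg e -> pmap (pinv e) = e.
Proof. by case: e => ? ? [] *; rewrite /pmap !cinvK. Qed.

Let pmap_cont z : pdom z -> {for z, continuous pmap}.
Proof.
by case: z => x y [/= cx dy]; exact: continuous_map_pair (cmap_cont cx) (cmap_cont dy).
Qed.

Let pinv_cont e : pimg e -> {for e, continuous pinv}.
Proof.
by case: e => x y [/= cx dy]; exact: continuous_map_pair (cinv_cont cx) (cinv_cont dy).
Qed.

Definition prod_chart : chart (T * T')%type (E * E')%type :=
  Chart pdom_open pimg_open pmap_img pinv_dom pmapK pinvK pmap_cont pinv_cont.

End ProductChart.

Context (A : smooth_atlas T E) (B : smooth_atlas T' E').

Let pchart (z : T * T') := prod_chart (chart_at A z.1) (chart_at B z.2).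

Let pchart_mem z : cdom (pchart z) z.
Proof. by split; exact: chart_at_mem. Qed.

Let pchart_compat z w :
  smooth_on [set e | cimg (pchart z) e /\ cdom (pchart w) (cinv (pchart z) e)]
            (pchart w \o cinv (pchart z)).
Proof.
have trans_open (S : topologicalType) (G : normedModType R) (c d : chart S G) :
    open [set e | cimg c e /\ cdom d (cinv c e)].
  rewrite openE => e [ce de]; apply: filterI.
    by apply: open_nbhs_nbhs; split=> //; exact: cimg_open.
  by apply: (cinv_cont ce); apply: open_nbhs_nbhs; split=> //; exact: cdom_open.
rewrite (_ : [set e | _] =
    [set e | cimg (chart_at A z.1) e /\
             cdom (chart_at A w.1) (cinv (chart_at A z.1) e)] `*`
    [set e | cimg (chart_at B z.2) e /\
             cdom (chart_at B w.2) (cinv (chart_at B z.2) e)]); last first.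
  by apply/seteqP; split=> -[e e'] /= [] [? ?] [? ?].
apply: (smooth_on_map_pair
  (f := chart_at A w.1 \o cinv (chart_at A z.1))
  (g := chart_at B w.2 \o cinv (chart_at B z.2))).
- by apply: open_setX.
- exact: chart_at_compat.
- exact: chart_at_compat.
Qed.

Definition prod_atlas : smooth_atlas (T * T')%type (E * E')%type :=
  SmoothAtlas pchart_mem pchart_compat.

End ProductAtlas.

Section VectorSpaceAtlas.
Context (R : realType) (E : normedModType R).

Let id_cont (x : E) : setT x -> {for x, continuous id}.
Proof. by move=> _; exact: cvg_id. Qed.

Let id_chart : chart E E :=
  Chart openT openT (fun _ _ => I) (fun _ _ => I)
    (fun _ _ => erefl) (fun _ _ => erefl) id_cont id_cont.

Definition vec_atlas : smooth_atlas E E :=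
  @SmoothAtlas R E E (fun=> id_chart) (fun=> I)
    (fun _ _ => @smooth_on_id R E _).

End VectorSpaceAtlas.
Arguments vec_atlas {R} E.

Section Manifolds.
Context (R : realType).

Section Maps.
Context (T T' : topologicalType) (E E' : normedModType R).
Context (A : smooth_atlas T E) (B : smooth_atlas T' E').

Definition msmooth_on (U : set T) (f : T -> T') : Prop :=
  (forall x, U x -> {for x, continuous f}) /\
  (forall x y,
     smooth_on [set e | [/\ cimg (chart_at A x) e, U (cinv (chart_at A x) e) &
                            cdom (chart_at B y) (f (cinv (chart_at A x) e))]]
               (chart_at B y \o f \o cinv (chart_at A x))).

(* Smoothness on an arbitrary subset, by local smooth extension. *)
Definition msmooth_subset (S : set T) (f : T -> T') : Prop :=
  forall x, S x -> exists (U : set T) (g : T -> T'),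
    [/\ open U, U x, msmooth_on U g & forall y, S y -> U y -> f y = g y].

Definition mdiff (f : T -> T') (x : T) : E -> E' :=
  'd (chart_at B (f x) \o f \o cinv (chart_at A x)) (chart_at A x x).

End Maps.

Definition smooth_chart (T : topologicalType) (E F : normedModType R)
    (A : smooth_atlas T E) (c : chart T F) : Prop :=
  msmooth_on A (vec_atlas F) (cdom c) c /\
  msmooth_on (vec_atlas F) A (cimg c) (cinv c).

(* Embedded submanifolds of codimension [k], via slice charts.  The dimension
   [l] of the slice is forced, since [c] is a diffeomorphism. *)
Definition submanifold (T : topologicalType) (E : normedModType R)
    (A : smooth_atlas T E) (S : set T) (k : nat) : Prop :=
  forall x, S x -> exists (l : nat) (c : chart T ('rV[R]_k * 'rV[R]_l)%type),
    [/\ smooth_chart A c, cdom c x &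
        S `&` cdom c = [set y | cdom c y /\ (c y).1 = 0]].

(* Velocities at [x] of smooth curves contained in [S]: the tangent space
   of [S] at [x] when [S] is a submanifold. *)
Definition tangent_set (T : topologicalType) (E : normedModType R)
    (A : smooth_atlas T E) (S : set T) (x : T) : set E :=
  [set v | exists (e : R) (gamma : R^o -> T),
     [/\ 0 < e, msmooth_on (vec_atlas R^o) A `]-e, e[%classic gamma,
         gamma 0 = x, (forall t, `]-e, e[%classic t -> S (gamma t)) &
         mdiff (vec_atlas R^o) A gamma 0 1 = v]].

(* [f] restricts to an embedding of the submanifold [S]: an injective immersion
   which is a homeomorphism onto its image. *)
Definition embedding_on (T T' : topologicalType) (E E' : normedModType R)
    (A : smooth_atlas T E) (B : smooth_atlas T' E') (S : set T) (f : T -> T')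
    : Prop :=
  [/\ exists U, [/\ open U, S `<=` U & msmooth_on A B U f],
      (forall x, S x -> set_inj (tangent_set A S x) (mdiff A B f x)),
      set_inj S f &
      (forall O, open O -> exists O', open O' /\
                   f @` (S `&` O) = f @` S `&` O')].

(* A vector field assigns to [x] the coordinates of a tangent vector at [x] in
   the chart [chart_at A x]; [field_rep A X y] is its expression in the
   coordinates of [chart_at A y]. *)
Definition field_rep (T : topologicalType) (E : normedModType R)
    (A : smooth_atlas T E) (X : T -> E) (y : T) (e : E) : E :=
  let x := cinv (chart_at A y) e in
  'd (chart_at A y \o cinv (chart_at A x)) (chart_at A x x) (X x).

Definition lie_derivative (T : topologicalType) (E : normedModType R)
    (A : smooth_atlas T E) (X : T -> E) (f : T -> R^o) (x : T) : R^o :=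
  mdiff A (vec_atlas R^o) f x (X x).

End Manifolds.

Section Contacts.
Context (R : realType) (M : smooth_surface R) (m : nat).
Context (X : 'rV[R]_m -> M -> 'rV[R]_2) (h : 'rV[R]_m -> M -> R^o).

Definition total_atlas :
    smooth_atlas (M * 'rV[R]_m)%type ('rV[R]_2 * 'rV[R]_m)%type :=
  prod_atlas (surf_atlas M) (vec_atlas 'rV[R]_m).

(* Joint smoothness in (z, p) on M x P. *)
Definition smooth_field_family (P : set 'rV[R]_m) : Prop :=
  forall y : M, smooth_on (cimg (chart_at (surf_atlas M) y) `*` P)
    (fun ep => field_rep (surf_atlas M) (X ep.2) y ep.1).

Definition smooth_function_family (P : set 'rV[R]_m) : Prop :=
  msmooth_on total_atlas (vec_atlas R^o) (setT `*` P) (fun zp => h zp.2 zp.1).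

Definition contact_fun (k : nat) (zp : M * 'rV[R]_m) : R^o :=
  iter k (lie_derivative (surf_atlas M) (X zp.2)) (h zp.2) zp.1.

Definition contact_jet (nu : nat) (zp : M * 'rV[R]_m) : 'rV[R]_nu :=
  \row_(i < nu) contact_fun i zp.

Definition contact_of_order (nu : nat) (zp : M * 'rV[R]_m) : Prop :=
  contact_jet nu zp = 0 /\ contact_fun nu zp <> 0.

Definition transverse_contact (nu : nat) (z : M) (p : 'rV[R]_m) : Prop :=
  [/\ contact_of_order nu (z, p),
      \dim (limg (linfun
        (mdiff total_atlas (vec_atlas 'rV[R]_nu) (contact_jet nu) (z, p)))) = nu,
      X p z <> 0 &
      mdiff (surf_atlas M) (vec_atlas R^o) (h p) z <> (fun=> 0)].

Definition incidence (P : set 'rV[R]_m) (nu : nat) : set (M * 'rV[R]_m) :=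
  [set zp | P zp.2 /\ contact_jet nu zp = 0].

End Contacts.

(* Main.v *)
Require Import Defs.
From HB Require Import structures.
From mathcomp Require Import all_boot all_order all_algebra.
From mathcomp Require Import all_classical all_reals all_analysis.
From mathcomp Require Import ring lra.
Import Order.TTheory GRing.Theory Num.Theory.
Import numFieldNormedType.Exports.
Local Open Scope classical_set_scope.
Local Open Scope ring_scope.

(** Write [H_k] for the iterated Lie derivatives of the switching function, so
    that differentiating [H_k] along the field gives [H_(k+1)].  At a contact of
    order [nu] the functions [H_0, ..., H_(nu-1)] vanish and [H_nu] does not.
    Hence the covector [d_z H_0], which is nonzero, kills the vector [X], whereas
    [d_z H_(nu-1)] takes the nonzero value [H_nu] on it.  On a tangent plane of
    dimension two these covectors are therefore a basis of the dual
    ([plane_functionals_injective]), and the two equations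
    [H_0 = H_(nu-1) = 0] can be solved for the point: [z = zeta p] with [zeta]
    smooth.  Near the given contact the incidence set is thus the graph of [zeta]
    over the set where the [nu - 2] remaining functions
    [p |-> H_i (zeta p, p)], [0 < i < nu - 1], vanish.

    Ambient transversality says that the differential of [(H_0, ..., H_(nu-1))]
    in [(z, p)] is onto.  So the incidence set is a level set of a submersion,
    which gives its codimension [nu].  A tangent vector [(u, q)] on which [d H_0]
    and [d H_(nu-1)] vanish has [u = d zeta q]; so prescribing the values of the
    other differentials amounts to choosing [q], and the [nu - 2] reduced
    functions form a submersion on the parameter space, which gives the
    codimension of the image.  The projection is an embedding because
    [p |-> (zeta p, p)] inverts it smoothly.  All this is gathered, in
    coordinates, in [local_contact_model].

    The analytic input is the inverse function theorem [inverse_function] and its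
    corollary [submersion_chart]: a submersion is the first component of a chart.
    The local inverse is a fixed point of a contraction; it is smooth because, by
    Cramer's rule, its derivative is a smooth expression in the inverse itself. *)

Set Implicit Arguments.
Unset Strict Implicit.
Unset Printing Implicit Defensive.

(** * Calculus of C^k maps *)

Section CkCalculus.
Context (R : realType).
Implicit Types E F G : normedModType R.

Lemma Ck_on_sub E F k (U V : set E) (f : E -> F) :
  V `<=` U -> Ck_on k U f -> Ck_on k V f.
Proof.
move=> VU; elim: k f => [|k IH] f /=; first by move=> cf x /VU; exact: cf.
by move=> [df Df]; split=> [x /VU|v]; [exact: df|exact: IH].
Qed.

Lemma smooth_on_sub E F (U V : set E) (f : E -> F) :
  V `<=` U -> smooth_on U f -> smooth_on V f.
Proof. by move=> VU sf k; exact: Ck_on_sub (sf k). Qed.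

Lemma Ck_onW E F k (U : set E) (f : E -> F) : Ck_on k.+1 U f -> Ck_on k U f.
Proof.
elim: k f => [|k IH] f [df Df] /=.
  by move=> x Ux; exact/differentiable_continuous/df.
by split=> // v; exact: IH (Df v).
Qed.

Lemma smooth_on_differentiable E F (U : set E) (f : E -> F) x :
  smooth_on U f -> U x -> differentiable f x.
Proof. by move=> sf Ux; have [df _] := sf 1%N; exact: df. Qed.

Lemma smooth_on_continuous E F (U : set E) (f : E -> F) x :
  smooth_on U f -> U x -> {for x, continuous f}.
Proof. by move=> sf Ux; exact: sf 0%N x Ux. Qed.

Lemma smooth_on_derive E F (U : set E) (f : E -> F) v :
  smooth_on U f -> smooth_on U (fun x => 'D_v f x).
Proof. by move=> sf k; have [_ Df] := sf k.+1; exact: Df. Qed.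

Lemma smooth_on_linear E F (U : set E) (L : {linear E -> F}) :
  continuous L -> smooth_on U L.
Proof.
move=> cL [|k] /=; first by move=> x _; exact: cL.
split=> [x _|v]; first exact: linear_differentiable.
rewrite (_ : (fun x => 'D_v L x) = fun=> L v); first exact: Ck_on_cst.
by apply/funext => x; rewrite deriveE ?diff_lin//; exact: linear_differentiable.
Qed.

Lemma Ck_on_linear_comp E F G k (U : set E) (L : {linear F -> G}) (f : E -> F) :
  open U -> continuous L -> Ck_on k U f -> Ck_on k U (L \o f).
Proof.
move=> oU cL; elim: k f => [|k IH] f /=.
  by move=> cf x Ux; apply: continuous_comp; [exact: cf|exact: cL].
move=> [df Df]; have dL y : differentiable L y by exact: linear_differentiable.
split=> [x Ux|v]; first by apply: differentiable_comp => //; exact: df.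
apply: Ck_on_ext (IH _ (Df v)) => // x Ux.
rewrite [in RHS]deriveE; last by apply: differentiable_comp => //; exact: df.
by rewrite diff_comp ?diff_lin//= -?deriveE//; exact: df.
Qed.

Lemma smooth_on_linear_comp E F G (U : set E) (L : {linear F -> G})
    (f : E -> F) :
  open U -> continuous L -> smooth_on U f -> smooth_on U (L \o f).
Proof. by move=> oU cL sf k; exact: Ck_on_linear_comp. Qed.

Lemma Ck_on_pair E F G k (U : set E) (f : E -> F) (g : E -> G) : open U ->
  Ck_on k U f -> Ck_on k U g -> Ck_on k U (fun x => (f x, g x)).
Proof.
move=> oU; elim: k f g => [|k IH] f g /=.
  by move=> cf cg x Ux; apply: cvg_pair; [exact: cf|exact: cg].
move=> [df Df] [dg Dg].
split=> [x Ux|v]; first by apply: differentiable_pair; [exact: df|exact: dg].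
apply: Ck_on_ext (IH _ _ (Df v) (Dg v)) => // x Ux.
have [dfx dgx] := (df x Ux, dg x Ux).
by rewrite [in RHS]deriveE ?diff_pair ?deriveE//; exact: differentiable_pair.
Qed.

Lemma smooth_on_pair E F G (U : set E) (f : E -> F) (g : E -> G) : open U ->
  smooth_on U f -> smooth_on U g -> smooth_on U (fun x => (f x, g x)).
Proof. by move=> oU sf sg k; exact: Ck_on_pair. Qed.

Lemma Ck_on_add E F k (U : set E) (f g : E -> F) : open U ->
  Ck_on k U f -> Ck_on k U g -> Ck_on k U (fun x => f x + g x).
Proof.
move=> oU; elim: k f g => [|k IH] f g /=.
  by move=> cf cg x Ux; apply: cvgD; [exact: cf|exact: cg].
move=> [df Df] [dg Dg].
split=> [x Ux|v]; first by apply: differentiableD; [exact: df|exact: dg].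
apply: Ck_on_ext (IH _ _ (Df v) (Dg v)) => // x Ux.
by rewrite deriveD//; apply: diff_derivable; [exact: df|exact: dg].
Qed.

Lemma Ck_on_sum E F (I : Type) (r : seq I) (P : pred I) k (U : set E)
    (f : I -> E -> F) : open U ->
  (forall i, P i -> Ck_on k U (f i)) ->
  Ck_on k U (fun x => \sum_(i <- r | P i) f i x).
Proof.
move=> oU cf; elim: r => [|i r IH].
  by apply: Ck_on_ext (Ck_on_cst _ _ 0) => // x _; rewrite big_nil.
have [Pi|Pi] := boolP (P i); last first.
  by apply: Ck_on_ext IH => // x _; rewrite big_cons (negbTE Pi).
by apply: Ck_on_ext (Ck_on_add oU (cf i Pi) IH) => // x _; rewrite big_cons Pi.
Qed.

Section Scale.
Context F.

Lemma scale_is_bilinear :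
  bilinear_for (GRing.Scale.Law.clone _ _ *:%R _)
    (GRing.Scale.Law.clone _ _ *:%R _) ( *:%R : R^o -> F -> F).
Proof.
split=> [u|u] a x y /=; first by rewrite scalerDl scalerA.
by rewrite scalerDr !scalerA mulrC.
Qed.

HB.instance Definition _ := bilinear_isBilinear.Build R R^o F F _ _
  ( *:%R : R^o -> F -> F) scale_is_bilinear.

Lemma differentiable_scale E (a : E -> R^o) (f : E -> F) x :
  differentiable a x -> differentiable f x ->
  differentiable (fun y => a y *: f y) x /\
  forall v, 'D_v (fun y => a y *: f y) x = 'D_v a x *: f x + a x *: 'D_v f x.
Proof.
move=> da df.
pose s : R^o * F -> F := fun p => p.1 *: p.2.
have cs : continuous s.
  by move=> p; apply: cvgZ; [exact: cvg_fst|exact: cvg_snd].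
have ds p : differentiable s p by exact: (@differentiable_bilin _ _ _ _ *:%R).
have dp : differentiable (fun y => (a y, f y)) x by exact: differentiable_pair.
have dsp : differentiable (s \o (fun y => (a y, f y))) x.
  exact: differentiable_comp.
split=> [//|v].
rewrite -[X in 'D_v X x]/(s \o (fun y => (a y, f y))) deriveE// diff_comp//=.
rewrite (@diff_bilin _ _ _ _ *:%R)// diff_pair//= addrC.
by rewrite !deriveE.
Qed.

Lemma Ck_on_scale E k (U : set E) (a : E -> R^o) (f : E -> F) : open U ->
  Ck_on k U a -> Ck_on k U f -> Ck_on k U (fun x => a x *: f x).
Proof.
move=> oU; elim: k a f => [|k IH] a f.
  by move=> ca cf x Ux; apply: cvgZ; [exact: ca|exact: cf].
move=> ca cf; have := (ca, cf) => -[/= [da Da] [df Df]].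
split=> [x Ux|v].
  by have [] := differentiable_scale (da x Ux) (df x Ux).
have H : Ck_on k U (fun x => 'D_v a x *: f x + a x *: 'D_v f x).
  apply: Ck_on_add => //.
    by apply: IH; [exact: Da|exact: Ck_onW].
  by apply: IH; [exact: Ck_onW|exact: Df].
apply: Ck_on_ext H => // x Ux.
by have [_ ->] := differentiable_scale (da x Ux) (df x Ux).
Qed.

End Scale.

Lemma Ck_on_prod E (I : Type) (r : seq I) k (U : set E) (f : I -> E -> R^o) :
  open U -> (forall i, Ck_on k U (f i)) ->
  Ck_on k U (fun x => \prod_(i <- r) (f i x : R) : R^o).
Proof.
move=> oU cf; elim: r => [|i r IH].
  by apply: Ck_on_ext (Ck_on_cst _ _ (1 : R^o)) => // x _; rewrite big_nil.
apply: Ck_on_ext (@Ck_on_scale R^o _ k U (f i) _ oU (cf i) IH) => // x _.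
by rewrite big_cons.
Qed.

Lemma Ck_on_inv E k (U : set E) (f : E -> R^o) : open U ->
  (forall x, U x -> f x != 0) ->
  Ck_on k U f -> Ck_on k U (fun x => (f x : R)^-1 : R^o).
Proof.
move=> oU f0; elim: k => [|k IH].
  by move=> cf x Ux; apply: cvgV; [exact: f0|exact: cf].
move=> cf; have [df Df] := cf.
split=> [x Ux|v]; first by apply: differentiableV; [exact: df|exact: f0].
have I2 := IH (Ck_onW cf).
have H : Ck_on k U (fun x => (- 1 : R^o) *: (((f x : R)^-1 : R^o) *:
    (((f x : R)^-1 : R^o) *: ('D_v f x : R^o)))).
  apply: (@Ck_on_scale R^o) => //; first exact: Ck_on_cst.
  apply: (@Ck_on_scale R^o) => //; apply: (@Ck_on_scale R^o) => //.
  exact: Df.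
apply: Ck_on_ext H => // x Ux.
rewrite deriveV ?f0//; last exact/diff_derivable/df.
by rewrite scaleN1r scalerA -invfM -expr2 scaleNr.
Qed.

Lemma Ck_on_det E n k (U : set E) (A : E -> 'M[R]_n) : open U ->
  (forall i j, Ck_on k U (fun x => A x i j : R^o)) ->
  Ck_on k U (fun x => \det (A x) : R^o).
Proof.
move=> oU cA; rewrite /determinant; apply: Ck_on_sum => // s _.
apply: (@Ck_on_scale R^o) => //; first exact: Ck_on_cst.
exact: Ck_on_prod.
Qed.

(** Cramer's rule expresses the inverse matrix through determinants, that is,
    through polynomials in the entries, and one division. *)
Lemma Ck_on_invmx E n k (U : set E) (A : E -> 'M[R]_n) : open U ->
  (forall x, U x -> A x \in unitmx) ->
  (forall i j, Ck_on k U (fun x => A x i j : R^o)) ->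
  forall i j, Ck_on k U (fun x => invmx (A x) i j : R^o).
Proof.
move=> oU uA cA i j.
have H : Ck_on k U (fun x => ((\det (A x))^-1 : R^o) *:
   (cofactor (A x) j i : R^o)).
  apply: Ck_on_scale => //.
    apply: Ck_on_inv => //; last exact: Ck_on_det.
    by move=> x /uA; rewrite unitmxE unitfE.
  apply: (@Ck_on_scale R^o) => //; first exact: Ck_on_cst.
  apply: Ck_on_det => // a b.
  by apply: Ck_on_ext (cA (lift j a) (lift i b)) => // x _; rewrite !mxE.
by apply: Ck_on_ext H => // x Ux; rewrite /invmx uA// !mxE.
Qed.

Lemma rV_sum n (v : 'rV[R]_n) : v = \sum_(i < n) v 0 i *: delta_mx 0 i.
Proof.
apply/rowP => j; rewrite summxE (bigD1 j)//= !mxE !eqxx mulr1 big1 ?addr0//.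
by move=> i ij; rewrite !mxE eqxx/= eq_sym (negbTE ij) mulr0.
Qed.

(** Linear maps out of a coordinate space are combinations of the coordinate
    functions, which are continuous. *)
Lemma rV_linear_continuous F n (L : {linear 'rV[R]_n -> F}) : continuous L.
Proof.
rewrite (_ : (L : _ -> _) =
    fun v : 'rV_n => \sum_(i < n) v 0 i *: L (delta_mx 0 i)).
  have c0 : Ck_on 0 setT
      (fun v : 'rV[R]_n => \sum_(i < n) (v 0 i : R^o) *: L (delta_mx 0 i)).
    apply: (Ck_on_sum _ openT) => i _.
    apply: (Ck_on_scale openT); last exact: Ck_on_cst.
    by move=> v _; exact: coord_continuous.
  by move=> v; exact: c0.
apply/funext => v; rewrite [in LHS](rV_sum v) linear_sum.
by apply: eq_bigr => i _; rewrite linearZ.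
Qed.

Lemma Ck_on_rV E n k (U : set E) (f : E -> 'rV[R]_n) : open U ->
  (forall i, Ck_on k U (fun x => f x 0 i : R^o)) -> Ck_on k U f.
Proof.
move=> oU cf.
have H : Ck_on k U
    (fun x => \sum_(i < n) (f x 0 i : R^o) *: (delta_mx 0 i : 'rV[R]_n)).
  by apply: Ck_on_sum => // i _; apply: Ck_on_scale => //; exact: Ck_on_cst.
by apply: Ck_on_ext H => // x _; rewrite -rV_sum.
Qed.

Lemma smooth_on_rV E n (U : set E) (f : E -> 'rV[R]_n) : open U ->
  (forall i, smooth_on U (fun x => f x 0 i : R^o)) -> smooth_on U f.
Proof. by move=> oU sf k; apply: Ck_on_rV => // i; exact: sf. Qed.

Lemma Ck_on_coord E m n k (U : set E) (f : E -> 'M[R]_(m, n)) i j : open U ->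
  Ck_on k U f -> Ck_on k U (fun x => f x i j : R^o).
Proof.
move=> oU cf.
have lc : linear (fun A : 'M[R]_(m, n) => A i j : R^o).
  by move=> a A B; rewrite !mxE.
pose L : {linear 'M[R]_(m, n) -> R^o} :=
  HB.pack (fun A : 'M[R]_(m, n) => A i j : R^o)
    (GRing.isLinear.Build _ _ _ _ _ lc).
by apply: (@Ck_on_linear_comp _ _ _ k U L) => // A; exact: coord_continuous.
Qed.

End CkCalculus.

(** * Linear coordinates, composition, and operations on charts *)

(** A linear homeomorphism with a coordinate space.  It gives a basis of [E]
    together with continuous coordinates, which is what is needed to expand a
    differential into finitely many directional derivatives. *)
Record coords (R : realType) (E : normedModType R) (n : nat) := Coords {
  vec : {linear E -> 'rV[R]_n};
  unvec : {linear 'rV[R]_n -> E};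
  vec_continuous : continuous vec;
  vecK : cancel vec unvec;
  unvecK : cancel unvec vec
}.

Section CoordsTheory.
Context (R : realType).
Implicit Types E F G : normedModType R.

Definition rV_coords n : coords 'rV[R]_n n :=
  @Coords R 'rV[R]_n n idfun idfun (fun x => cvg_id)
    (fun _ => erefl) (fun _ => erefl).

Lemma unvec_continuous E n (c : coords E n) : continuous (unvec c).
Proof. exact: rV_linear_continuous. Qed.

Lemma coords_linear_continuous E F n (c : coords E n) (L : {linear E -> F}) :
  continuous L.
Proof.
have cL : continuous (L \o unvec c) by exact: rV_linear_continuous.
rewrite (_ : (L : _ -> _) = (L \o unvec c) \o vec c); last first.
  by apply/funext => x /=; rewrite vecK.
by move=> x; apply: continuous_comp; [exact: vec_continuous|exact: cL].
Qed.

Section Prod.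
Context E F m n (c : coords E m) (d : coords F n).

Let pvec (x : E * F) : 'rV[R]_(m + n) := row_mx (vec c x.1) (vec d x.2).
Let punvec (v : 'rV[R]_(m + n)) : E * F :=
  (unvec c (lsubmx v), unvec d (rsubmx v)).

Let pvec_linear : linear pvec.
Proof.
by move=> a x y; rewrite /pvec/= !linearP/= -add_row_mx -scale_row_mx.
Qed.

Let punvec_linear : linear punvec.
Proof. by move=> a x y; rewrite /punvec/= !linearP. Qed.

HB.instance Definition _ := GRing.isLinear.Build _ _ _ _ pvec pvec_linear.
HB.instance Definition _ := GRing.isLinear.Build _ _ _ _ punvec punvec_linear.

Let pvec_continuous : continuous pvec.
Proof.
have ll : linear (fun v : 'rV[R]_m => row_mx v 0 : 'rV[R]_(m + n)).
  by move=> a x y; rewrite -[in LHS](addr0 0) -add_row_mx scale_row_mx scaler0.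
have lr : linear (fun v : 'rV[R]_n => row_mx 0 v : 'rV[R]_(m + n)).
  by move=> a x y; rewrite -[in LHS](addr0 0) -add_row_mx scale_row_mx scaler0.
pose L : {linear 'rV[R]_m -> 'rV[R]_(m + n)} :=
  HB.pack (fun v : 'rV[R]_m => row_mx v 0 : 'rV[R]_(m + n))
  (GRing.isLinear.Build _ _ _ _ _ ll).
pose L' : {linear 'rV[R]_n -> 'rV[R]_(m + n)} :=
  HB.pack (fun v : 'rV[R]_n => row_mx 0 v : 'rV[R]_(m + n))
  (GRing.isLinear.Build _ _ _ _ _ lr).
rewrite (_ : pvec = fun x => L (vec c x.1) + L' (vec d x.2)); last first.
  by apply/funext => x; rewrite /= add_row_mx addr0 add0r.
move=> x; apply: cvgD.
  apply: (@continuous_comp _ _ _ (fun x => vec c x.1) L).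
    by apply: (@continuous_comp _ _ _ fst (vec c));
      [exact: cvg_fst|exact: vec_continuous].
  exact: rV_linear_continuous.
apply: (@continuous_comp _ _ _ (fun x => vec d x.2) L').
  by apply: (@continuous_comp _ _ _ snd (vec d));
    [exact: cvg_snd|exact: vec_continuous].
exact: rV_linear_continuous.
Qed.

Let pvecK : cancel pvec punvec.
Proof. by case=> x y; rewrite /punvec row_mxKl row_mxKr !vecK. Qed.

Let punvecK : cancel punvec pvec.
Proof. by move=> v; rewrite /pvec !unvecK hsubmxK. Qed.

Definition prod_coords : coords (E * F)%type (m + n) :=
  @Coords R (E * F)%type (m + n) pvec punvec pvec_continuous pvecK punvecK.

End Prod.

Lemma derive_coords E F n (c : coords E n) (f : E -> F) x v :
  differentiable f x ->
  'D_v f x = \sum_(i < n) vec c v 0 i *: 'D_(unvec c (delta_mx 0 i)) f x.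
Proof.
move=> df; under eq_bigr do rewrite deriveE// -linearZ -linearZ.
by rewrite -linear_sum -linear_sum -rV_sum vecK deriveE.
Qed.

(** The C^k condition only speaks of derivatives along a fixed direction, but the
    chain rule produces the derivative of [f] along the moving direction
    ['D_v g x].  Coordinates on the intermediate space turn the latter into a
    combination of derivatives along fixed basis vectors. *)
Lemma Ck_on_comp E F G n (c : coords F n) k (U : set E) (V : set F)
    (f : F -> G) (g : E -> F) : open U -> open V ->
  (forall x, U x -> V (g x)) -> Ck_on k U g -> Ck_on k V f ->
  Ck_on k U (f \o g).
Proof.
move=> oU oV UV; elim: k f g UV => [|k IH] f g UV.
  by move=> cg cf x Ux; apply: continuous_comp; [exact: cg|exact/cf/UV].
move=> cg cf; have [[dg Dg] [df Df]] := (cg, cf).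
split=> [x Ux|v].
  by apply: differentiable_comp; [exact: dg|exact/df/UV].
have H : Ck_on k U (fun x => \sum_(i < n) (vec c ('D_v g x) 0 i : R^o) *:
    ((fun y => 'D_(unvec c (delta_mx 0 i)) f y) \o g) x).
  apply: Ck_on_sum => // i _; apply: Ck_on_scale => //.
    apply: (@Ck_on_coord _ _ _ _ _ _ (fun x => vec c ('D_v g x))) => //.
    apply: (@Ck_on_linear_comp _ _ _ _ _ _ _ (fun x => 'D_v g x)) => //.
      exact: vec_continuous.
    exact: Dg.
  exact: IH _ g UV (Ck_onW cg) (Df _).
apply: Ck_on_ext H => // x Ux; rewrite -derive_coords; last exact/df/UV.
have [dgx dfx] := (dg x Ux, df _ (UV x Ux)).
have dfg : differentiable (f \o g) x by exact: differentiable_comp.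
by rewrite (deriveE _ dfg) (deriveE _ dfx) (deriveE _ dgx) (diff_comp dgx dfx).
Qed.

Lemma smooth_on_comp E F G n (c : coords F n) (U : set E) (V : set F)
    (f : F -> G) (g : E -> F) : open U -> open V ->
  (forall x, U x -> V (g x)) -> smooth_on U g -> smooth_on V f ->
  smooth_on U (f \o g).
Proof.
by move=> oU oV UV sg sf k; exact: (Ck_on_comp c oU oV UV (sg k) (sf k)).
Qed.

End CoordsTheory.

Lemma open_preimage_on (S T : topologicalType) (A : set S) (B : set T)
    (f : S -> T) : open A -> open B ->
  (forall x, A x -> {for x, continuous f}) -> open (A `&` f @^-1` B).
Proof.
move=> oA oB cf; rewrite openE => x [Ax Bfx]; apply: filterI.
  exact: open_nbhs_nbhs.
by apply: (cf x Ax); exact: open_nbhs_nbhs.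
Qed.

Section ChartOps.
Context (R : realType).

Section Comp.
Context (T : topologicalType) (E F : normedModType R).
Context (c : chart T E) (d : chart E F).

Let dom := cdom c `&` c @^-1` cdom d.
Let img := cimg d `&` cinv d @^-1` cimg c.

Let dom_open : open dom.
Proof. by apply: open_preimage_on; [exact: cdom_open..|exact: cmap_cont]. Qed.

Let img_open : open img.
Proof. by apply: open_preimage_on; [exact: cimg_open..|exact: cinv_cont]. Qed.

Let map_img x : dom x -> img ((d \o c) x).
Proof.
move=> [cx dx]; split; first exact: cmap_img.
by rewrite /= cmapK//; exact: cmap_img.
Qed.

Let inv_dom e : img e -> dom ((cinv c \o cinv d) e).
Proof.
move=> [de ce]; split; first exact: cinv_dom.
by rewrite /= cinvK//; exact: cinv_dom.
Qed.

Let mapK x : dom x -> (cinv c \o cinv d) ((d \o c) x) = x.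
Proof. by move=> [cx dx] /=; rewrite !cmapK. Qed.

Let invK e : img e -> (d \o c) ((cinv c \o cinv d) e) = e.
Proof. by move=> [de ce] /=; rewrite !cinvK. Qed.

Let map_cont x : dom x -> {for x, continuous (d \o c)}.
Proof. by move=> [cx dx]; apply: continuous_comp; exact: cmap_cont. Qed.

Let inv_cont e : img e -> {for e, continuous (cinv c \o cinv d)}.
Proof. by move=> [de ce]; apply: continuous_comp; exact: cinv_cont. Qed.

Definition comp_chart : chart T F :=
  Chart dom_open img_open map_img inv_dom mapK invK map_cont inv_cont.

End Comp.

Section Restrict.
Context (T : topologicalType) (E : normedModType R) (c : chart T E).
Context (V : set T) (oV : open V).

Let dom := cdom c `&` V.
Let img := cimg c `&` cinv c @^-1` V.

Let dom_open : open dom.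
Proof. by apply: openI => //; exact: cdom_open. Qed.

Let img_open : open img.
Proof.
by apply: open_preimage_on => //; [exact: cimg_open|exact: cinv_cont].
Qed.

Let map_img x : dom x -> img (c x).
Proof. by move=> [cx Vx]; split; [exact: cmap_img|rewrite /= cmapK]. Qed.

Let inv_dom e : img e -> dom (cinv c e).
Proof. by move=> [ce Ve]; split => //; exact: cinv_dom. Qed.

Let mapK x : dom x -> cinv c (c x) = x.
Proof. by move=> [cx _]; rewrite cmapK. Qed.

Let invK e : img e -> c (cinv c e) = e.
Proof. by move=> [ce _]; rewrite cinvK. Qed.

Let map_cont x : dom x -> {for x, continuous c}.
Proof. by move=> [cx _]; exact: cmap_cont. Qed.

Let inv_cont e : img e -> {for e, continuous (cinv c)}.
Proof. by move=> [ce _]; exact: cinv_cont. Qed.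

Definition restrict_chart : chart T E :=
  Chart dom_open img_open map_img inv_dom mapK invK map_cont inv_cont.

End Restrict.

Section Linear.
Context (E F : normedModType R) (L : {linear E -> F}) (L' : {linear F -> E}).
Context (cL : continuous L) (cL' : continuous L').
Context (LK : cancel L L') (L'K : cancel L' L).

Definition linear_chart : chart E F :=
  @Chart R E F setT setT L L' openT openT (fun _ _ => I) (fun _ _ => I)
    (fun x _ => LK x) (fun y _ => L'K y) (fun x _ => @cL x) (fun y _ => @cL' y).

End Linear.

(** A chart between normed spaces that is smooth in both directions. *)
Definition diffeo (E F : normedModType R) (d : chart E F) :=
  smooth_on (cdom d) d /\ smooth_on (cimg d) (cinv d).

Lemma diffeo_comp (E F G : normedModType R) n (k : coords F n)
    (c : chart E F) (d : chart F G) :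
  diffeo c -> diffeo d -> diffeo (comp_chart c d).
Proof.
move=> [sc sci] [sd sdi]; split => /=.
  apply: (smooth_on_comp k (V := cdom d)) => //.
  - exact: (cdom_open (comp_chart c d)).
  - exact: cdom_open.
  - by move=> x [].
  - by apply: smooth_on_sub sc => x [].
apply: (smooth_on_comp k (V := cimg c)) => //.
- exact: (cimg_open (comp_chart c d)).
- exact: cimg_open.
- by move=> x [].
- by apply: smooth_on_sub sdi => x [].
Qed.

Lemma diffeo_linear (E F : normedModType R) (L : {linear E -> F})
    (L' : {linear F -> E}) (cL : continuous L) (cL' : continuous L')
    (LK : cancel L L') (L'K : cancel L' L) :
  diffeo (linear_chart cL cL' LK L'K).
Proof. by split; exact: smooth_on_linear. Qed.

Section SmoothCharts.
Context (T : topologicalType) (E F : normedModType R) (n : nat).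
Context (k : coords E n) (A : smooth_atlas T E).

Lemma smooth_chart_restrict (c : chart T F) (V : set T) (oV : open V) :
  smooth_chart A c -> smooth_chart A (restrict_chart c oV).
Proof.
move=> [[c1 s1] [c2 s2]]; split; split.
- by move=> x [cx _]; exact: c1.
- by move=> x y; apply: smooth_on_sub (s1 x y) => e [? []].
- by move=> x [cx _]; exact: c2.
- by move=> x y; apply: smooth_on_sub (s2 x y) => e [? []].
Qed.

(** The compatibility of the atlas reduces smoothness in an arbitrary chart to
    smoothness in the chart at [x0], and there it is the smoothness of [d]. *)
Lemma smooth_chart_comp (x0 : T) (d : chart E F) :
  diffeo d -> smooth_chart A (comp_chart (chart_at A x0) d).
Proof.
move=> [sd sdi].
set c := comp_chart _ _.
split; split.
- exact: (@cmap_cont _ _ _ c).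
- move=> x y.
  set U := (X in smooth_on X _).
  have UE : U = cimg (chart_at A x) `&` cinv (chart_at A x) @^-1` cdom c.
    by apply/seteqP; split=> e /= [? ?].
  have oU : open U.
    rewrite UE; apply: open_preimage_on.
    - exact: cimg_open.
    - exact: cdom_open.
    - exact: cinv_cont.
  apply: (@smooth_on_comp _ _ _ _ _ k U (cdom d) d
    (chart_at A x0 \o cinv (chart_at A x))) => //.
  + exact: cdom_open.
  + by rewrite UE => e [_ []].
  + by apply: smooth_on_sub (chart_at_compat A x x0); rewrite UE => e [? []].
- exact: (@cinv_cont _ _ _ c).
- move=> x y.
  set U := (X in smooth_on X _).
  have UE : U = cimg c `&` cinv c @^-1` cdom (chart_at A y).
    by apply/seteqP; split=> e /=; [case|case].
  have oU : open U.
    rewrite UE; apply: open_preimage_on.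
    - exact: cimg_open.
    - exact: cdom_open.
    - exact: cinv_cont.
  have oV : open (cimg (chart_at A x0) `&`
      cinv (chart_at A x0) @^-1` cdom (chart_at A y)).
    apply: open_preimage_on.
    - exact: cimg_open.
    - exact: cdom_open.
    - exact: cinv_cont.
  apply: (@smooth_on_comp _ _ _ _ _ k U _
    (chart_at A y \o cinv (chart_at A x0)) (cinv d) oU oV).
  + by rewrite UE => e [[? ?] ?]; split.
  + by apply: smooth_on_sub sdi; rewrite UE => e [[]].
  + exact: chart_at_compat.
Qed.

Lemma smooth_chart_vec (d : chart E F) :
  diffeo d -> smooth_chart (vec_atlas E) d.
Proof.
move=> [sd sdi]; split; split.
- exact: cmap_cont.
- by move=> x y; apply: smooth_on_sub sd => e [].
- exact: cinv_cont.
- by move=> x y; apply: smooth_on_sub sdi => e [].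
Qed.

End SmoothCharts.

End ChartOps.

(** * Mean value inequality and strict differentiability *)

Section InverseFunction.
Context (R : realType).

Lemma derive_linear (E F : normedModType R) (L : {linear E -> F}) x v :
  continuous L -> 'D_v L x = L v.
Proof.
by move=> cL; rewrite deriveE ?diff_lin//; exact: linear_differentiable.
Qed.

Lemma derive_coord (E : normedModType R) m n (f : E -> 'M[R]_(m, n)) x v i j :
  differentiable f x -> 'D_v (fun z => f z i j : R) x = 'D_v f x i j.
Proof. by move=> df; rewrite derive_mx ?mxE//; exact: diff_derivable. Qed.

Lemma mx_entry_le (m n : nat) (A : 'M[R]_(m, n)) i j : `|A i j| <= `|A|.
Proof.
by rewrite [leRHS]/Num.Def.normr/= mx_normrE; exact: (le_bigmax _ _ (i, j)).
Qed.

Lemma rV_norm_le n (v : 'rV[R]_n) c :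
  0 <= c -> (forall i, `|v 0 i| <= c) -> `|v| <= c.
Proof.
move=> c0 vc; rewrite /Num.Def.normr/= mx_normrE.
apply: bigmax_le => // -[i j] _ /=.
by rewrite ord1.
Qed.

Lemma ball_segment (E : normedModType R) (x0 x y : E) r t :
  0 <= t -> t <= 1 -> ball x0 r x -> ball x0 r y ->
  ball x0 r (y + t *: (x - y)).
Proof.
rewrite -ball_normE /ball_/= => t0 t1 xr yr.
rewrite (_ : x0 - _ = t *: (x0 - x) + (1 - t) *: (x0 - y)); last first.
  have -> : x - y = (x0 - y) - (x0 - x) by rewrite opprB [RHS]addrC subrKA.
  by rewrite opprD addrA scalerBr opprB scalerBl scale1r addrCA.
rewrite (le_lt_trans (ler_normD _ _))// !normrZ !ger0_norm ?subr_ge0//.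
have [->|tn0] := eqVneq t 0; first by rewrite mul0r add0r subr0 mul1r.
apply: (@lt_le_trans _ _ (t * r + (1 - t) * r)); last first.
  by rewrite -mulrDl addrC subrK mul1r.
have t_gt0 : 0 < t by rewrite lt_def tn0.
apply: ltr_leD; first by rewrite ltr_pM2l.
by apply: ler_wpM2l; [rewrite subr_ge0|exact: ltW].
Qed.

(** The one-variable mean value theorem on the segment from [y] to [x], which
    stays in the ball. *)
Lemma mean_value_ball (E : normedModType R) (g : E -> R) (x0 : E) r c :
  (forall z, ball x0 r z -> differentiable g z) ->
  (forall z v, ball x0 r z -> `|'D_v g z| <= c * `|v|) ->
  forall x y, ball x0 r x -> ball x0 r y -> `|g x - g y| <= c * `|x - y|.
Proof.
move=> dg Dg x y bx b_y.
pose l (t : R) : E := y + t *: (x - y).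
have dl t : differentiable l t.
  by apply: differentiableD => //; exact: differentiableZl.
have Dl t : 'd l t 1 = x - y.
  rewrite -deriveE// deriveD//.
    rewrite derive_cst add0r deriveE; last exact: differentiableZl.
    by rewrite diffZl//= diff_val scale1r.
  exact/diff_derivable/differentiableZl.
have bl (t : R) : t \in `[0, 1] -> ball x0 r (l t).
  by rewrite in_itv/= => /andP[t0 t1]; exact: ball_segment.
have dgl (t : R) : t \in `[0, 1] -> differentiable (g \o l) t.
  by move=> /bl bt; apply: differentiable_comp => //; exact: dg.
have [t t01] : exists2 t : R, t \in `]0, 1[%R &
    (g \o l) 1 - (g \o l) 0 = 'D_(x - y) g (l t) * (1 - 0).
  apply: (@MVT R (g \o l) (fun t => 'D_(x - y) g (l t)) 0 1 ltr01) => [t t01|].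
    have t01' : t \in `[0, 1]%R by exact: subset_itv_oo_cc t01.
    apply: DeriveDef; first exact/diff_derivable/dgl.
    rewrite deriveE; last exact: dgl.
    rewrite diff_comp//=; last exact/dg/bl.
    by rewrite Dl -deriveE//; exact/dg/bl.
  apply: derivable_within_continuous => t t01.
  exact/diff_derivable/dgl.
rewrite subr0 mulr1 /= /l scale1r scale0r addr0 [y + _]addrC subrK => ->.
by apply: Dg; apply: bl; exact: subset_itv_oo_cc t01.
Qed.

(** Continuity of the finitely many partial derivatives makes the derivative of
    [f] uniformly close to its value at [x0] on a small ball; the mean value
    inequality, applied to the components of [f - 'd f x0], turns this into a
    Lipschitz estimate.  The bound on derivatives is kept in the conclusion
    because it also shows that the derivative stays injective nearby. *)
Lemma strict_derivative n p (f : 'rV[R]_n -> 'rV[R]_p) (U : set 'rV[R]_n) x0 e :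
  open U -> U x0 -> smooth_on U f -> 0 < e ->
  exists2 r, 0 < r & [/\ ball x0 r `<=` U,
    forall z v, ball x0 r z -> `|'D_v f z - 'D_v f x0| <= e * `|v| &
    forall x y, ball x0 r x -> ball x0 r y ->
      `|f x - f y - 'd f x0 (x - y)| <= e * `|x - y|].
Proof.
move=> oU Ux0 sf e0.
(* The derivative along a vector is a sum of n partial derivatives; dividing by
   n.+1 rather than n covers the zero-dimensional case. *)
pose d : R := e / n.+1%:R.
have d0 : 0 < d by rewrite divr_gt0.
have : \forall z \near x0, U z /\ forall j : 'I_n,
    `|'D_(delta_mx 0 j) f z - 'D_(delta_mx 0 j) f x0| < d.
  near=> z; split; first by near: z; exact: open_nbhs_nbhs.
  near: z; apply: filter_forall => j.
  have := smooth_on_continuous (smooth_on_derive (delta_mx 0 j) sf) Ux0.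
  by move=> /cvgrPdistC_lt /(_ d d0).
move=> /nbhs_ballP[r /= r0 rH]; exists r => //.
have rU : ball x0 r `<=` U by move=> z /rH[].
have df z : ball x0 r z -> differentiable f z.
  by move=> /rU; exact: smooth_on_differentiable.
have df0 : differentiable f x0 by apply: df; exact: ballxx.
have DH z v : ball x0 r z -> `|'D_v f z - 'D_v f x0| <= e * `|v|.
  move=> bz; rewrite !(derive_coords (rV_coords R n))//; last exact: df.
  rewrite -sumrB /=; under eq_bigr do rewrite -scalerBr.
  rewrite (le_trans (ler_norm_sum _ _ _))//.
  apply: (@le_trans _ _ (\sum_(i < n) `|v| * d)).
    apply: ler_sum => i _; rewrite normrZ ler_pM// ?mx_entry_le// ltW//.
    by have [_] := rH _ bz; exact.
  rewrite sumr_const card_ord -mulr_natr -mulrA [leRHS]mulrC ler_wpM2l//.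
  by rewrite /d mulrAC ler_pdivrMr// ler_wpM2l ?ltW// ltr_nat.
split=> // x y bx b_y.
apply: rV_norm_le; first by rewrite mulr_ge0// ltW.
move=> i.
pose g (z : 'rV[R]_n) : R := f z 0 i - 'd f x0 z 0 i.
have dc (q : nat) (w : 'rV[R]_q) (j : 'I_q) :
    differentiable (fun v : 'rV[R]_q => v 0 j : R) w.
  exact: differentiable_coord.
have dl z : differentiable ('d f x0) z.
  exact/linear_differentiable/diff_continuous.
have d1 z : ball x0 r z ->
    differentiable ((fun v : 'rV[R]_p => v 0 i : R) \o f) z.
  by move=> bz; apply: differentiable_comp => //; exact: df.
have d2 z : differentiable ((fun v : 'rV[R]_p => v 0 i : R) \o 'd f x0) z.
  exact: differentiable_comp.
have : `|g x - g y| <= e * `|x - y|.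
  apply: (@mean_value_ball _ g x0 r e) => // [z bz|z v bz].
    by apply: differentiableB => //; exact: d1.
  apply: le_trans (DH z v bz); apply: le_trans (mx_entry_le _ 0 i).
  rewrite /g deriveB; try by apply: diff_derivable => //; exact: d1.
  have -> : 'D_v (fun z => f z 0 i : R) z = 'D_v f z 0 i.
    by apply: derive_coord; exact: df.
  have -> : 'D_v (fun z => 'd f x0 z 0 i : R) z = 'D_v f x0 0 i.
    rewrite (derive_coord _ _ _ (dl z)).
    by rewrite (derive_linear _ _ (diff_continuous df0)) deriveE.
  by rewrite !mxE.
suff -> : (f x - f y - 'd f x0 (x - y)) 0 i = g x - g y by [].
by rewrite /g linearB/= !mxE; ring.
Unshelve. all: by end_near. Qed.

End InverseFunction.

(** * Local inverses of maps close to the identity *)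

(** Joins completeness and the norm on matrices, as the fixed point theorem
    requires. *)
HB.instance Definition _ (R : realType) (m n : nat) :=
  Uniform_isComplete.Build 'M[R]_(m, n) (@mx_complete R m n).

Section NearIdentity.
Context (R : realType) (E : completeNormedModType R).
Context (f : E -> E) (x0 : E) (r : R).
Hypothesis r_gt0 : 0 < r.
Hypothesis f_near_id : forall x y, ball x0 r x -> ball x0 r y ->
  `|f x - f y - (x - y)| <= 2^-1 * `|x - y|.

Lemma near_id_expand x y : ball x0 r x -> ball x0 r y ->
  `|x - y| <= 2 * `|f x - f y|.
Proof.
move=> bx b_y; have := f_near_id bx b_y.
have := ler_distD (f x - f y) (x - y) 0; rewrite !subr0 distrC; lra.
Qed.

Lemma near_id_shrink x y : ball x0 r x -> ball x0 r y ->
  `|f x - f y| <= 2 * `|x - y|.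
Proof.
move=> bx b_y; have := f_near_id bx b_y.
have := ler_distD (x - y) (f x - f y) 0; rewrite !subr0.
have := normr_ge0 (x - y); lra.
Qed.

(** The solutions of [f x = y] are the fixed points of [x |-> x - (f x - y)],
    which is a contraction of constant 1/2.  It maps the closed ball of radius
    [r / 2] to itself when [y] is within [r / 4] of [f x0]. *)
Lemma near_id_surj y :
  ball (f x0) (r / 4) y -> exists2 x, ball x0 r x & f x = y.
Proof.
move=> yb.
pose D := [set x | `|x0 - x| <= r / 2].
have Db x : D x -> ball x0 r x.
  move=> xD; rewrite -ball_normE /=; apply: le_lt_trans xD _.
  have := r_gt0; lra.
have cD : closed D.
  rewrite (_ : D = closed_ball_ Num.norm x0 (r / 2)) //.
  exact: closed_closed_ball_.
pose T x := x - (f x - y).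
have TD : {homo T : x / D x >-> D x}.
  move=> x Dx; rewrite /D/= /T.
  have := f_near_id (Db _ Dx) (ballxx x0 r_gt0).
  have := Dx; rewrite /D/= => Dx'.
  have := yb; rewrite -ball_normE/= => yb'.
  have -> : x0 - (x - (f x - y)) = (f x - f x0 - (x - x0)) + (f x0 - y).
    by rewrite [RHS]addrAC subrKA !opprB addrCA.
  have := ler_normD (f x - f x0 - (x - x0)) (f x0 - y).
  rewrite [`|x - x0|]distrC; lra.
have q : is_contraction (mkfun_fun (fun x Dx => TD x Dx) : {fun D >-> D}).
  exists 2^-1%:nng; split=> /=; first by lra.
  move=> [x x'] [/= /Db bx /Db bx'].
  have -> : T x - T x' = - (f x - f x' - (x - x')).
    rewrite /T (opprB x') [_ - x']addrC addrACA (opprB (f x)).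
    by rewrite [y - _ + _]addrC subrKA opprB (opprB (f x)).
  by rewrite normrN; exact: f_near_id.
have [|x Dx xT] := banach_fixed_point q cD.
  by exists x0; rewrite /D/= subrr normr0 divr_ge0// ltW.
exists x; first exact: Db.
move: xT => /= /eqP; rewrite /T eq_sym -subr_eq0 addrC addKr oppr_eq0 subr_eq0.
by move/eqP.
Qed.

Let inv y := xget x0 [set x | ball x0 r x /\ f x = y].

Let inv_spec y : ball (f x0) (r / 4) y -> ball x0 r (inv y) /\ f (inv y) = y.
Proof. move=> /near_id_surj[x bx fx].
by apply: (@xgetPex _ x0 [set x | ball x0 r x /\ f x = y]); exists x. Qed.

Let dom := ball x0 r `&` f @^-1` ball (f x0) (r / 4).
Let img := ball (f x0) (r / 4).

Let lip_continuous (g : E -> E) (U : set E) : open U ->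
  (forall x y, U x -> U y -> `|g x - g y| <= 2 * `|x - y|) ->
  forall x, U x -> {for x, continuous g}.
Proof.
move=> oU gU x Ux; apply/cvgrPdist_lt => e e0.
near=> y.
apply: (@le_lt_trans _ _ (2 * `|x - y|)).
  by apply: gU => //; near: y; exact: open_nbhs_nbhs.
rewrite -ltr_pdivlMl//; near: y; apply/nbhs_normP.
by exists (2^-1 * e) => //=; rewrite mulr_gt0.
Unshelve. all: by end_near. Qed.

Let map_cont0 x : ball x0 r x -> {for x, continuous f}.
Proof. by apply: lip_continuous; [exact: ball_open|exact: near_id_shrink]. Qed.

Let dom_open : open dom.
Proof. by apply: open_preimage_on; [exact: ball_open..|exact: map_cont0]. Qed.

Let img_open : open img.
Proof. by apply: ball_open; rewrite divr_gt0. Qed.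

Let map_img x : dom x -> img (f x). Proof. by case. Qed.

Let inv_dom y : img y -> dom (inv y).
Proof. by move=> iy; have [? e] := inv_spec iy; split; rewrite //= e. Qed.

Let mapK x : dom x -> inv (f x) = x.
Proof.
move=> [bx /inv_spec[b_y e]].
have := near_id_expand b_y bx.
by rewrite e subrr normr0 mulr0 normr_le0 subr_eq0 => /eqP.
Qed.

Let invK y : img y -> f (inv y) = y. Proof. by move=> /inv_spec[]. Qed.

Lemma near_id_inverse_lipschitz x y :
  img x -> img y -> `|inv x - inv y| <= 2 * `|x - y|.
Proof.
move=> /inv_spec[bx ex] /inv_spec[b_y ey].
by have := near_id_expand bx b_y; rewrite ex ey.
Qed.

Let map_cont x : dom x -> {for x, continuous f}.
Proof. by move=> [bx _]; exact: map_cont0. Qed.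

Let inv_cont y : img y -> {for y, continuous inv}.
Proof. by apply: lip_continuous => //; exact: near_id_inverse_lipschitz. Qed.

Definition near_id_chart : chart E E :=
  Chart dom_open img_open map_img inv_dom mapK invK map_cont inv_cont.

End NearIdentity.

Section SmoothInverse.
Context (R : realType).

(** If [f] is differentiable at [g y] with left-invertible derivative and [g] is
    a Lipschitz right inverse of [f] near [y], put [w = g (z + y) - g y].  Then
    [w - B z = - B (z - 'd f w)] is small compared with [w], hence with [z]. *)
Lemma inverse_differentiable (E F : normedModType R) (f : E -> F) (g : F -> E)
    (y : F) (B : {linear F -> E}) (K : R) : continuous B ->
  differentiable f (g y) -> (forall v, B ('d f (g y) v) = v) ->
  (\forall z \near y, f (g z) = z /\ `|g z - g y| <= K * `|z - y|) ->
  differentiable g y /\ ('d g y = B :> (F -> E)).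
Proof.
move=> cB df BK ng.
have [fgy _] := nbhs_singleton ng.
have [b b0 Bb] := linear_lipschitz cB.
suff H : g \o shift y = cst (g y) + B +o_ 0 id.
  have dE : 'd g y = B :> (F -> E) by exact: diff_unique.
  by split=> //; apply/diff_locallyP; rewrite dE.
apply/eqaddoP => e e0.
(* A positive Lipschitz constant, so that one may divide by it. *)
pose K' := `|K| + 1.
have K'0 : 0 < K' by rewrite ltr_pwDr.
pose d := e / (b * K').
have d0 : 0 < d by rewrite divr_gt0// mulr_gt0.
have /eqaddoP/(_ d d0) := diff_locally df.
move=> /nbhs_normP[r /= r0 rH].
have ng0 : \forall z \near (0 : F),
    f (g (z + y)) = z + y /\ `|g (z + y) - g y| <= K * `|z|.
  have := ng; rewrite (near_shift 0 y) subr0.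
  by apply: filterS => z /=; rewrite addrK.
near=> z.
have [fgz gz] : f (g (z + y)) = z + y /\ `|g (z + y) - g y| <= K * `|z|.
  by near: z.
pose w := g (z + y) - g y.
have wz : `|w| <= K' * `|z|.
  apply: le_trans gz _; rewrite ler_wpM2r// (le_trans (ler_norm K))//.
  by rewrite lerDl.
have zr : `|z| < K'^-1 * r.
  near: z; apply/nbhs_normP; exists (K'^-1 * r).
    by rewrite /= mulr_gt0 ?invr_gt0.
  by move=> z /=; rewrite sub0r normrN.
have /rH /= : `|0 - w| < r.
  by rewrite sub0r normrN (le_lt_trans wz)// -ltr_pdivlMl.
rewrite !fctE /= subrK fgz fgy opprD addrA addrK => wH.
have -> : g (z + y) - (g y + B z) = - B (z - 'd f (g y) w).
  by rewrite linearB BK opprB opprD addrA.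
rewrite normrN (le_trans (Bb _))// (le_trans (ler_wpM2l (ltW b0) wH))//.
rewrite (le_trans (ler_wpM2l (ltW b0) (ler_wpM2l (ltW d0) wz)))//.
rewrite !mulrA /d; apply: ler_wpM2r => //.
by rewrite (_ : _ * K' = e)//; field; rewrite !gt_eqF.
Unshelve. all: by end_near. Qed.

(** Bootstrapping: the derivative of the inverse at [y] is the inverse of the
    Jacobian matrix of [d] at [cinv d y].  If the inverse is of class C^k, so is
    this matrix, and then the inverse is of class C^(k+1). *)
Lemma smooth_chart_inverse n (d : chart 'rV[R]_n 'rV[R]_n) (K : R) :
  smooth_on (cdom d) d ->
  (forall x v, cdom d x -> 'd d x v = 0 -> v = 0) ->
  (forall y z, cimg d y -> cimg d z ->
    `|cinv d y - cinv d z| <= K * `|y - z|) ->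
  smooth_on (cimg d) (cinv d).
Proof.
move=> sd dinj dlip.
pose J y : 'M[R]_n := lin1_mx ('d d (cinv d y)).
have JE y v : v *m J y = 'd d (cinv d y) v by rewrite mul_rV_lin1.
have Ju y : cimg d y -> J y \in unitmx.
  move=> iy; rewrite -row_free_unit -kermx_eq0; apply/rowV0P => v /sub_kermxP.
  by rewrite JE; apply: dinj; exact: cinv_dom.
have dd x : cdom d x -> differentiable d x by exact: smooth_on_differentiable.
have oI := cimg_open d.
have dinv y : cimg d y -> differentiable (cinv d) y /\
    (forall v, 'D_v (cinv d) y = v *m invmx (J y)).
  move=> iy.
  have [||||dy dE] := @inverse_differentiable _ _ d (cinv d) y
      (mulmxr (invmx (J y))) K.
  - exact: rV_linear_continuous.
  - exact/dd/cinv_dom.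
  - by move=> v; rewrite /= -JE mulmxK ?Ju.
  - near=> z.
    have iz : cimg d z by near: z; exact: open_nbhs_nbhs.
    by split; [exact: cinvK|exact: dlip].
  by split=> // v; rewrite deriveE// dE.
elim=> [|k IH]; first by move=> y iy; exact: cinv_cont.
split=> [y iy|v]; first by have [] := dinv y iy.
have H : Ck_on k (cimg d) (fun y => v *m invmx (J y)).
  apply: Ck_on_rV => // i.
  have H : Ck_on k (cimg d)
      (fun y => \sum_j (v 0 j : R^o) *: (invmx (J y) j i : R^o)).
    apply: Ck_on_sum => // j _; apply: (@Ck_on_scale _ R^o) => //.
      exact: Ck_on_cst.
    apply: Ck_on_invmx => // a c.
    have H : Ck_on k (cimg d) ((fun x => 'D_(delta_mx 0 a) d x) \o cinv d).
      apply: (Ck_on_comp (rV_coords R n) oI (cdom_open d)) => //.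
        exact: cinv_dom.
      exact: smooth_on_derive.
    apply: Ck_on_ext (Ck_on_coord 0 c oI H) => // y iy.
    by rewrite /= deriveE ?rowE ?mxE//; exact/dd/cinv_dom.
  by apply: Ck_on_ext H => // y iy; rewrite mxE.
by apply: Ck_on_ext H => // y iy; have [_ ->] := dinv y iy.
Unshelve. all: by end_near. Qed.

End SmoothInverse.

(** * The inverse function theorem and charts adapted to a submersion *)

Section InverseFunctionTheorem.
Context (R : realType).

Lemma diff_linear_comp (E F G : normedModType R) (L : {linear F -> G})
    (f : E -> F) x v : continuous L -> differentiable f x ->
  'd (L \o f) x v = L ('d f x v).
Proof.
move=> cL df; have dL : differentiable L (f x) by exact: linear_differentiable.
by rewrite diff_comp//= (diff_lin _ cL).
Qed.

(** Following [f] by the inverse of its derivative at [x0] gives a map with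
    derivative the identity, to which [near_id_chart] applies. *)
Lemma inverse_function_rV n (f : 'rV[R]_n -> 'rV[R]_n) (U : set 'rV[R]_n) x0 :
  open U -> U x0 -> smooth_on U f ->
  (forall v, 'd f x0 v = 0 -> v = 0) ->
  exists d : chart 'rV[R]_n 'rV[R]_n,
    [/\ diffeo d, cdom d x0, cdom d `<=` U & forall x, d x = f x].
Proof.
move=> oU Ux0 sf dinj.
pose A : 'M[R]_n := lin1_mx ('d f x0).
have AE v : v *m A = 'd f x0 v by rewrite mul_rV_lin1.
have uA : A \in unitmx.
  rewrite -row_free_unit -kermx_eq0; apply/rowV0P => v /sub_kermxP.
  by rewrite AE; exact: dinj.
pose f1 := mulmxr (invmx A) \o f.
have sf1 : smooth_on U f1.
  by apply: smooth_on_linear_comp => //; exact: rV_linear_continuous.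
have df : differentiable f x0 by exact: smooth_on_differentiable sf Ux0.
have df1 x : U x -> differentiable f1 x by exact: smooth_on_differentiable sf1.
have df1E v : 'd f1 x0 v = v.
  have cL : continuous (mulmxr (invmx A) : 'rV[R]_n -> 'rV[R]_n).
    exact: rV_linear_continuous.
  by rewrite (diff_linear_comp _ cL df) -AE /= mulmxK.
have h0 : (0 : R) < 2^-1 by [].
have [r r0 [rU D1 D2]] := strict_derivative oU Ux0 sf1 h0.
have near1 x y : ball x0 r x -> ball x0 r y ->
    `|f1 x - f1 y - (x - y)| <= 2^-1 * `|x - y|.
  by move=> bx b_y; have := D2 x y bx b_y; rewrite df1E.
pose c := near_id_chart r0 near1.
have cr : cdom c `<=` ball x0 r by move=> x [].
have dc : diffeo c.
  have sc : smooth_on (cdom c) c.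
    by apply: smooth_on_sub sf1 => x /cr; exact: rU.
  split=> //; apply: (smooth_chart_inverse sc (K := 2)).
  - move=> x v /cr bx; rewrite -deriveE => [D0|]; last exact/df1/rU.
    have := D1 x v bx; rewrite [X in X - _]D0 deriveE; last exact/df1.
    rewrite df1E sub0r normrN => ?; apply/eqP; rewrite -normr_le0; lra.
  - exact: near_id_inverse_lipschitz.
have cA : continuous (mulmxr A : 'rV[R]_n -> 'rV[R]_n).
  exact: rV_linear_continuous.
have cA' : continuous (mulmxr (invmx A) : 'rV[R]_n -> 'rV[R]_n).
  exact: rV_linear_continuous.
have AK : cancel (mulmxr A : 'rV[R]_n -> 'rV[R]_n) (mulmxr (invmx A)).
  by move=> v; rewrite /= mulmxK.
have A'K : cancel (mulmxr (invmx A) : 'rV[R]_n -> 'rV[R]_n) (mulmxr A).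
  by move=> v; rewrite /= mulmxKV.
exists (comp_chart c (linear_chart cA cA' AK A'K)); split.
- by apply: (diffeo_comp (rV_coords R n)) => //; exact: diffeo_linear.
- by split=> //; split; apply: ballxx; rewrite ?divr_gt0.
- by move=> x [/cr /rU].
- by move=> x /=; rewrite mulmxKV.
Qed.

Theorem inverse_function (E F : normedModType R) n (kE : coords E n)
    (kF : coords F n) (f : E -> F) (U : set E) x0 :
  open U -> U x0 -> smooth_on U f ->
  (forall v, 'd f x0 v = 0 -> v = 0) ->
  exists d : chart E F,
    [/\ diffeo d, cdom d x0, cdom d `<=` U & forall x, d x = f x].
Proof.
move=> oU Ux0 sf dinj.
have [cu cu'] := (@unvec_continuous _ _ _ kE, @unvec_continuous _ _ _ kF).
have [cv cv'] := (@vec_continuous _ _ _ kE, @vec_continuous _ _ _ kF).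
pose U' := unvec kE @^-1` U.
have oU' : open U' by apply: open_comp => // x _; exact: cu.
pose g := (vec kF \o f) \o unvec kE.
have sg : smooth_on U' g.
  apply: (smooth_on_comp kE (V := U)) => //.
    exact: smooth_on_linear.
  exact: smooth_on_linear_comp.
have U'x0 : U' (vec kE x0) by rewrite /U'/= vecK.
have [v|d [dd dx0 dU dE]] := inverse_function_rV oU' U'x0 sg.
  have df : differentiable f (unvec kE (vec kE x0)).
    by rewrite vecK; exact: smooth_on_differentiable sf Ux0.
  have du : differentiable (unvec kE) (vec kE x0).
    exact: linear_differentiable.
  have dfu : differentiable (f \o unvec kE) (vec kE x0).
    exact: differentiable_comp.
  have -> : 'd g (vec kE x0) v = vec kF ('d f x0 (unvec kE v)).
    rewrite (diff_linear_comp v cv' dfu) diff_comp//= (diff_lin _ cu).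
    by rewrite vecK.
  move=> H.
  rewrite -[v](unvecK kE) (dinj (unvec kE v)) ?linear0//.
  by rewrite -['d _ _ _](vecK kF) H linear0.
exists (comp_chart (linear_chart cv cu (vecK kE) (unvecK kE))
  (comp_chart d (linear_chart cu' cv' (unvecK kF) (vecK kF)))); split.
- apply: (diffeo_comp (rV_coords R n)); first exact: diffeo_linear.
  by apply: (diffeo_comp (rV_coords R n)) => //; exact: diffeo_linear.
- by split=> //; split.
- by move=> x [_ [/dU]]; rewrite /U'/= vecK.
- by move=> x /=; rewrite dE /g/= !vecK.
Qed.

(** The columns added to [A] are coordinates on its left kernel: there they
    detect every nonzero vector. *)
Lemma complement_columns n k (A : 'M[R]_(n, k)) :
  (forall w : 'rV[R]_k, exists v, v *m A = w) ->
  exists l (B : 'M[R]_(n, l)), (k + l = n)%N /\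
    forall v : 'rV[R]_n, v *m A = 0 -> v *m B = 0 -> v = 0.
Proof.
move=> surjA.
have rA : \rank A = k.
  apply/eqP; rewrite -[_ == _]/(row_full A) -sub1mx; apply/row_subP => i.
  by have [v <-] := surjA (row i 1%:M); exact: submxMl.
exists (\rank (kermx A)), (pinvmx (row_base (kermx A))); split.
  by rewrite mxrank_ker -{1}rA subnKC// rank_leq_row.
move=> v vA vB.
have /submxP[w vw] : (v <= row_base (kermx A))%MS.
  by rewrite eq_row_base; exact/sub_kermxP.
move: vB; rewrite vw -mulmxA mulmxVp ?row_base_free// mulmx1 => ->.
by rewrite mul0mx.
Qed.

(** Completing [f] by linear coordinates on the kernel of its derivative gives a
    map with injective derivative between spaces of the same dimension. *)
Theorem submersion_chart (E : normedModType R) n (kE : coords E n) k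
    (f : E -> 'rV[R]_k) (U : set E) x0 :
  open U -> U x0 -> smooth_on U f ->
  (forall w, exists v, 'd f x0 v = w) ->
  exists l (d : chart E ('rV[R]_k * 'rV[R]_l)%type),
    [/\ diffeo d, cdom d x0, cdom d `<=` U & forall x, (d x).1 = f x].
Proof.
move=> oU Ux0 sf surj.
pose A : 'M[R]_(n, k) := lin1_mx ('d f x0 \o unvec kE).
have AE v : v *m A = 'd f x0 (unvec kE v) by rewrite mul_rV_lin1.
have [|l [B [kl AB]]] := @complement_columns n k A.
  by move=> w; have [v <-] := surj w; exists (vec kE v); rewrite AE vecK.
have kF : coords ('rV[R]_k * 'rV[R]_l)%type n.
  by rewrite -kl; exact: prod_coords (rV_coords R k) (rV_coords R l).
pose L : {linear E -> 'rV[R]_l} := mulmxr B \o vec kE.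
have cL : continuous L by exact: coords_linear_continuous kE L.
pose g x := (f x, L x).
have sg : smooth_on U g by apply: smooth_on_pair => //; exact: smooth_on_linear.
have [v|d [dd dx0 dU dE]] := inverse_function kE kF oU Ux0 sg; last first.
  by exists l, d; split=> // x; rewrite dE.
have df : differentiable f x0 by exact: smooth_on_differentiable sf Ux0.
have dL : differentiable L x0 by exact: linear_differentiable.
rewrite /g diff_pair// (diff_lin _ cL) /= => -[fv Lv].
by rewrite -[v](vecK kE) (AB (vec kE v)) ?linear0// AE vecK.
Qed.

End InverseFunctionTheorem.

(** * Contact functions in a chart of the surface *)

Lemma near_eq_diff (R : realType) (E F : normedModType R) (f g : E -> F) x v :
  (\near x, f x = g x) -> differentiable f x -> 'd g x v = 'd f x v.
Proof.
move=> fg df; have dg := near_eq_differentiable fg df.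
by rewrite -!deriveE//; apply: near_eq_derive; apply: filterS fg => y ->.
Qed.

Section ContactFunctions.
Context (R : realType) (M : smooth_surface R) (m : nat) (P : set 'rV[R]_m).
Context (X : 'rV[R]_m -> M -> 'rV[R]_2) (h : 'rV[R]_m -> M -> R^o).
Hypotheses (oP : open P) (sX : smooth_field_family X P)
  (sh : smooth_function_family h P).

Let A := surf_atlas M.

(** The contact functions in the coordinates of the fixed chart at [y], where
    smoothness can be tested. *)
Definition contact_rep (y : M) (k : nat) (ep : 'rV[R]_2 * 'rV[R]_m) : R^o :=
  contact_fun X h k (cinv (chart_at (surf_atlas M) y) ep.1, ep.2).

Lemma chart_domain_open (y : M) : open (cimg (chart_at A y) `*` P).
Proof. by apply: open_setX => //; exact: cimg_open. Qed.

(** The Lie derivative at [z] is computed in the chart at [z], which moves with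
    the point.  The chain rule for the change of charts [tau] moves it to the
    fixed chart at [y], and carries [X p z] to the vector [field_rep A (X p) y e]
    whose smooth dependence on [(e, p)] is the hypothesis on the family. *)
Lemma contact_rep_succ (y : M) k e p : cimg (chart_at A y) e ->
  differentiable (contact_rep y k) (e, p) ->
  contact_rep y k.+1 (e, p) =
    'd (contact_rep y k) (e, p) (field_rep A (X p) y e, 0).
Proof.
move=> ce dH; rewrite /contact_rep/=.
set z := cinv (chart_at A y) e.
have cz : cdom (chart_at A z) z by exact: chart_at_mem.
have yz : cdom (chart_at A y) z by exact: cinv_dom.
set tau := chart_at A y \o cinv (chart_at A z).
have tauz : tau (chart_at A z z) = e by rewrite /tau/= cmapK// cinvK.
have dtau : differentiable tau (chart_at A z z).
  apply: smooth_on_differentiable (chart_at_compat A z y) _; split.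
    exact: cmap_img.
  by rewrite cmapK.
pose g e' := (tau e', p : 'rV[R]_m).
have dg : differentiable g (chart_at A z z).
  by apply: differentiable_pair.
have gz : g (chart_at A z z) = (e, p) by rewrite /g tauz.
rewrite /contact_fun/= {1}/lie_derivative/mdiff/=.
set phi := _ \o cinv (chart_at A z).
rewrite (@near_eq_diff _ _ _ (contact_rep y k \o g) phi).
- rewrite diff_comp ?gz//= /g diff_pair//= diff_cst.
  by rewrite /field_rep -/z.
- have oV : open (cimg (chart_at A z) `&`
      cinv (chart_at A z) @^-1` cdom (chart_at A y)).
    apply: open_preimage_on;
      [exact: cimg_open|exact: cdom_open|exact: cinv_cont].
  near=> e'.
  have [ce' ye'] : (cimg (chart_at A z) `&`
      cinv (chart_at A z) @^-1` cdom (chart_at A y)) e'.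
    near: e'; apply: open_nbhs_nbhs; split=> //; split; first exact: cmap_img.
    by rewrite /= cmapK.
  by rewrite /phi /contact_rep /contact_fun /g/tau/= cmapK.
- by apply: differentiable_comp => //; rewrite gz.
Unshelve. all: by end_near. Qed.

(** By [contact_rep_succ], [H_(k+1)] is a combination of the partial derivatives
    of [H_k] whose coefficients are the components of the field. *)
Lemma contact_rep_smooth (y : M) k :
  smooth_on (cimg (chart_at A y) `*` P) (contact_rep y k).
Proof.
have oU := @chart_domain_open y.
elim: k => [|k IH].
  have [_ /(_ (y, 0) 0)] := sh.
  by apply: smooth_on_sub => -[e p] [/= ce Pp]; split.
pose K := prod_coords (rV_coords R 2) (rV_coords R m).
move=> n.
have H : Ck_on n (cimg (chart_at A y) `*` P) (fun ep => \sum_(i < 2 + m)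
    (vec K (field_rep A (X ep.2) y ep.1, 0) 0 i : R^o) *:
    'D_(unvec K (delta_mx 0 i)) (contact_rep y k) ep).
  apply: Ck_on_sum => // i _; apply: Ck_on_scale => //; last first.
    exact: smooth_on_derive IH n.
  apply: (@Ck_on_coord _ _ _ _ _ _
    (fun ep => vec K (field_rep A (X ep.2) y ep.1, 0))) => //.
  apply: (@Ck_on_linear_comp _ _ _ _ _ _ (vec K)
    (fun ep => (field_rep A (X ep.2) y ep.1, 0))) => //.
    exact: vec_continuous.
  by apply: Ck_on_pair => //; [exact: sX|exact: Ck_on_cst].
apply: Ck_on_ext H => // -[e p] [/= ce Pp].
have dH : differentiable (contact_rep y k) (e, p).
  exact: smooth_on_differentiable IH _.
rewrite contact_rep_succ// -(deriveE _ dH).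
by have := derive_coords K (field_rep A (X p) y e, 0) dH.
Qed.

End ContactFunctions.

(** * The local model of the incidence set *)

Lemma rank_surjective (K : fieldType) (U V : vectType K) (L : {linear U -> V}) :
  \dim (limg (linfun L)) = \dim {:V} -> forall w, exists v, L v = w.
Proof.
move=> dL w.
have /eqP : (limg (linfun L) == fullv)%VS by rewrite eqEdim subvf dL leqnn.
move=> limgE; have : w \in limg (linfun L) by rewrite limgE memvf.
by move=> /memv_imgP[v _ ->]; exists v; rewrite lfunE.
Qed.

(** Two functionals on the plane have trivial common kernel as soon as one of them
    is nonzero and kills a vector [w] that the other does not kill: a vector [u]
    killed by the first is proportional to [w]. *)
Lemma plane_functionals_injective (R : realType) (a b : 'rV[R]_2 -> R^o)
    (u0 w u : 'rV[R]_2) : linear a -> linear b ->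
  a u0 != 0 -> a w = 0 -> b w != 0 -> a u = 0 -> b u = 0 -> u = 0.
Proof.
move=> la lb.
have coordE (f : 'rV[R]_2 -> R^o) : linear f -> forall v,
    f v = v 0 0 * f (delta_mx 0 0) + v 0 1 * f (delta_mx 0 1).
  move=> lf v.
  have f0 : f 0 = 0.
    have := lf 1 0 0; rewrite !scale1r addr0 => /(congr1 (fun t => t - f 0)).
    by rewrite subrr addrK.
  have -> : v = v 0 0 *: delta_mx 0 0 + (v 0 1 *: delta_mx 0 1 + 0).
    rewrite addr0 [LHS]rV_sum big_ord_recl big_ord1.
    have -> : lift ord0 ord0 = 1 :> 'I_2 by exact: val_inj.
    by have -> : ord0 = 0 :> 'I_2 by exact: val_inj.
  by rewrite !lf f0 addr0 !mxE /= !mulr1 !mulr0 !addr0 add0r.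
rewrite (coordE _ la u0) (coordE _ la w) (coordE _ la u).
rewrite (coordE _ lb w) (coordE _ lb u).
set a1 := a _; set a2 := a _; set b1 := b _; set b2 := b _.
move=> au0 aw bw au bu.
(* The vectors u and w both lie in the line that a kills. *)
have det0 : u 0 0 * w 0 1 - u 0 1 * w 0 0 = 0.
  have E1 : a1 * (u 0 0 * w 0 1 - u 0 1 * w 0 0) = 0.
    transitivity ((u 0 0 * a1 + u 0 1 * a2) * w 0 1 -
      (w 0 0 * a1 + w 0 1 * a2) * u 0 1); first by ring.
    by rewrite au aw !mul0r subr0.
  have E2 : a2 * (u 0 0 * w 0 1 - u 0 1 * w 0 0) = 0.
    transitivity ((w 0 0 * a1 + w 0 1 * a2) * u 0 0 -
      (u 0 0 * a1 + u 0 1 * a2) * w 0 0); first by ring.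
    by rewrite au aw !mul0r subr0.
  have [a10|a10] := eqVneq a1 0; last first.
    by move/eqP: E1; rewrite mulf_eq0 (negbTE a10) => /eqP.
  move/eqP: E2; rewrite mulf_eq0 => /orP[/eqP a20|/eqP//].
  by move: au0; rewrite a10 a20 !mulr0 addr0 eqxx.
have u00 : u 0 0 = 0.
  apply: (mulIf bw); rewrite mul0r.
  transitivity (w 0 0 * (u 0 0 * b1 + u 0 1 * b2) +
    b2 * (u 0 0 * w 0 1 - u 0 1 * w 0 0)); first by ring.
  by rewrite bu det0 !mulr0 addr0.
have u01 : u 0 1 = 0.
  apply: (mulIf bw); rewrite mul0r.
  transitivity (w 0 1 * (u 0 0 * b1 + u 0 1 * b2) -
    b1 * (u 0 0 * w 0 1 - u 0 1 * w 0 0)); first by ring.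
  by rewrite bu det0 !mulr0 subr0.
apply/rowP => i; rewrite mxE; case: i => -[|[|//]] ip.
  by rewrite -u00; congr (u _ _); exact: val_inj.
by rewrite -u01; congr (u _ _); exact: val_inj.
Qed.

Lemma diff_coord (R : realType) (E : normedModType R) m n
    (f : E -> 'M[R]_(m, n)) x v i j : differentiable f x ->
  'd f x v i j = 'd (fun z => f z i j : R^o) x v.
Proof.
move=> df; rewrite -deriveE// -derive_coord// deriveE//.
apply: (@differentiable_comp _ _ _ _ f
  (fun A : 'M[R]_(m, n) => A i j : R)) => //.
exact: differentiable_coord.
Qed.

Section LocalModel.
Context (R : realType) (M : smooth_surface R) (m n : nat) (P : set 'rV[R]_m).
Context (X : 'rV[R]_m -> M -> 'rV[R]_2) (h : 'rV[R]_m -> M -> R^o).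
Context (z0 : M) (p0 : 'rV[R]_m).
Hypotheses (oP : open P) (sX : smooth_field_family X P)
  (sh : smooth_function_family h P) (Pp0 : P p0)
  (tc : transverse_contact X h n.+2 z0 p0).

Let c := chart_at (surf_atlas M) z0.
Let U : set ('rV[R]_2 * 'rV[R]_m) := cimg c `*` P.
Let a0 : 'rV[R]_2 * 'rV[R]_m := (c z0, p0).
Let H := contact_rep X h z0.
Let J (a : 'rV[R]_2 * 'rV[R]_m) : 'rV[R]_n.+2 := \row_(i < n.+2) H i a.
(** The map whose local inverse solves [H 0 = H n.+1 = 0] for the point, the
    parameter being kept as the second component. *)
Let Phi (a : 'rV[R]_2 * 'rV[R]_m) : 'rV[R]_2 * 'rV[R]_m :=
  (\row_(i < 2) (if i == 0 then H 0 a else H n.+1 a), a.2).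
Let K := prod_coords (rV_coords R 2) (rV_coords R m).

Let oU : open U. Proof. exact: chart_domain_open. Qed.

Let cz0 : cdom c z0. Proof. exact: chart_at_mem. Qed.

Let Ua0 : U a0. Proof. by split=> //=; exact: cmap_img. Qed.

Let sH k : smooth_on U (H k). Proof. exact: contact_rep_smooth. Qed.

Let dH k a : U a -> differentiable (H k) a.
Proof. by move=> Ua; exact: smooth_on_differentiable (sH k) Ua. Qed.

Let sJ : smooth_on U J.
Proof.
apply: smooth_on_rV => // i k; apply: Ck_on_ext (sH i k) => // a _.
by rewrite mxE.
Qed.

Let sPhi : smooth_on U Phi.
Proof.
apply: smooth_on_pair => //; last first.
  by apply: (@smooth_on_linear _ _ _ U snd) => a; exact: cvg_snd.
apply: smooth_on_rV => // i k; case: (eqVneq i 0) => [->|i0].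
  by apply: Ck_on_ext (sH 0 k) => // a _; rewrite mxE.
by apply: Ck_on_ext (sH n.+1 k) => // a _; rewrite mxE (negbTE i0).
Qed.

Let J0 : J a0 = 0.
Proof.
have [[Jz _] _ _ _] := tc; rewrite -[RHS]Jz; apply/rowP => i.
by rewrite !mxE /H /contact_rep/= cmapK.
Qed.

Let H0 k : (k < n.+2)%N -> H k a0 = 0.
Proof. by move=> kn; have /rowP/(_ (Ordinal kn)) := J0; rewrite !mxE. Qed.

Let Hn0 : H n.+2 a0 != 0.
Proof.
have [[_ /eqP Hn] _ _ _] := tc; move: Hn.
by rewrite /H /contact_rep/= cmapK.
Qed.

Let dJ_surj w : exists v, 'd J a0 v = w.
Proof.
have [_ dimJ _ _] := tc.
apply: rank_surjective; rewrite dimvf/= /dim/= mul1n.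
suff <- : mdiff (total_atlas M m) (vec_atlas _) (contact_jet X h n.+2) (z0, p0)
  = 'd J a0 :> (_ -> _) by exact: dimJ.
by rewrite /mdiff/=.
Qed.

Let dPhi v : 'd Phi a0 v =
  (\row_(i < 2) (if i == 0 then 'd (H 0) a0 v else 'd (H n.+1) a0 v), v.2).
Proof.
have [d0 d1] := (dH 0 Ua0, dH n.+1 Ua0).
have dPhi0 : differentiable Phi a0 by exact: smooth_on_differentiable sPhi Ua0.
have dr : differentiable (fst \o Phi) a0.
  apply: differentiable_comp => //.
  by apply: (linear_differentiable (f := fst)) => a; exact: cvg_fst.
have ds : differentiable (snd : 'rV[R]_2 * 'rV[R]_m -> 'rV[R]_m) a0.
  by apply: (linear_differentiable (f := snd)) => a; exact: cvg_snd.
rewrite (_ : Phi = fun a => ((fst \o Phi) a, snd a)) // (diff_pair dr ds) /=.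
congr (_, _).
  apply/rowP => i; rewrite diff_coord// [RHS]mxE.
  pose Hi : 'rV[R]_2 * 'rV[R]_m -> R^o := if i == 0 then H 0 else H n.+1.
  have -> : (fun a => (fst \o Phi) a 0 i : R^o) = Hi.
    by apply/funext => a; rewrite /Hi /= mxE; case: ifP.
  by rewrite /Hi; case: ifP.
by rewrite (diff_lin (f := snd))// => x; exact: cvg_snd.
Qed.

(** The value [w] of the field at the contact separates the two differentials:
    differentiating along it gives [H 1 = 0] for the first and [H n.+2 <> 0] for
    the second. *)
Let dPhi_inj v : 'd Phi a0 v = 0 -> v = 0.
Proof.
rewrite dPhi; case: v => u q -[/rowP uv /= q0]; rewrite q0 in uv *.
suff -> : u = 0 by [].
have [d0 d1] := (dH 0 Ua0, dH n.+1 Ua0).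
pose w := field_rep (surf_atlas M) (X p0) z0 (c z0).
have pairE0 (t : R) (x y : 'rV[R]_2) :
    (t *: x + y, 0 : 'rV[R]_m) = t *: (x, 0) + (y, 0).
  by congr (_, _); rewrite /= scaler0 addr0.
pose a u' : R^o := 'd (H 0) a0 (u', 0).
pose b u' : R^o := 'd (H n.+1) a0 (u', 0).
have la : linear a by move=> t x y; rewrite /a pairE0 linearP.
have lb : linear b by move=> t x y; rewrite /b pairE0 linearP.
have stepH k : 'd (H k) a0 (w, 0) = H k.+1 a0.
  by rewrite /H contact_rep_succ//; [exact: cmap_img|exact: dH].
have [u0 au0] : exists u0, a u0 != 0.
  have [_ _ _ dh] := tc; apply: contra_notP dh => /forallNP a0'.
  apply/funext => u0; have /negP := a0' u0; rewrite negbK => /eqP <-.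
  pose g (e : 'rV[R]_2) := (e, p0).
  have dg : differentiable g (c z0) by exact: differentiable_pair.
  have -> : mdiff (surf_atlas M) (vec_atlas R^o) (h p0) z0 u0 =
      'd (H 0 \o g) (c z0) u0 by [].
  have dgE : 'd g (c z0) u0 = (u0, 0).
    by rewrite /g diff_pair//= diff_cst diff_val.
  by rewrite (diff_comp dg d0) [LHS]/= dgE.
apply: (plane_functionals_injective la lb au0 (w := w)).
- by rewrite /a stepH H0.
- by rewrite /b stepH Hn0.
- by have := uv 0; rewrite !mxE eqxx.
- by have := uv 1; rewrite !mxE.
Qed.

(** Over the chart at [z0], the incidence set is cut out by [J], which is the
    first component of the chart [dJ]; it is also the graph of [theta] over the
    zero set of the first component of [dF].  The map [theta] comes from the
    local inverse of [Phi] on the slice where its first component vanishes, and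
    [dF] from the functions [H 1, ..., H n] restricted to that graph. *)
Lemma local_contact_model : exists (V : set ('rV[R]_2 * 'rV[R]_m))
    (theta : 'rV[R]_m -> 'rV[R]_2)
    l (dJ : chart ('rV[R]_2 * 'rV[R]_m)%type ('rV[R]_n.+2 * 'rV[R]_l)%type)
    l' (dF : chart 'rV[R]_m ('rV[R]_n * 'rV[R]_l')%type),
  [/\ [/\ open V, V a0, V `<=` U & forall a, V a -> H n.+2 a != 0],
      [/\ diffeo dJ, V `<=` cdom dJ & forall a, (dJ a).1 = J a],
      [/\ diffeo dF, forall a, V a -> cdom dF a.2, smooth_on (cdom dF) theta &
          forall p, cdom dF p -> U (theta p, p) /\
            ((dF p).1 = 0 <-> J (theta p, p) = 0)] &
      forall a, V a -> J a = 0 -> a.1 = theta a.2].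
Proof.
have [D [[sD sDi] Da0 DU DE]] := inverse_function K K oU Ua0 sPhi dPhi_inj.
pose i0 (p : 'rV[R]_m) : 'rV[R]_2 * 'rV[R]_m := (0, p).
have ci0 : continuous i0.
  by move=> p; apply: differentiable_continuous; exact: differentiable_pair.
pose N := i0 @^-1` cimg D.
have oN : open N by apply: open_comp => //; exact: cimg_open.
pose s p := cinv D (i0 p).
have sN : smooth_on N s.
  apply: (smooth_on_comp K (V := cimg D)) => //; first exact: cimg_open.
  apply: smooth_on_pair => //; last exact: smooth_on_id.
  by move=> k; exact: Ck_on_cst.
have Ds p : N p -> cdom D (s p) by move=> Np; exact: cinv_dom.
have Us p : N p -> U (s p) by move=> /Ds/DU.
have Phis p : N p -> Phi (s p) = (0, p) by move=> Np; rewrite -DE cinvK.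
have s2 p : N p -> (s p).2 = p by move=> /Phis[].
have Hs0 p : N p -> H 0 (s p) = 0.
  by move=> /Phis[/rowP/(_ 0)]; rewrite !mxE.
have Hsn p : N p -> H n.+1 (s p) = 0.
  by move=> /Phis[/rowP/(_ 1)]; rewrite !mxE.
have sE p : N p -> s p = ((s p).1, p).
  by move=> Np; rewrite -{3}(s2 _ Np) -surjective_pairing.
have Phia0 : Phi a0 = (0, p0).
  congr (_, _); apply/rowP => i; rewrite !mxE.
  by case: ifP => _; rewrite H0.
have Np0 : N p0 by rewrite /N/= /i0 -Phia0 -DE; exact: cmap_img.
have sp0 : s p0 = a0 by rewrite /s /i0 -Phia0 -DE cmapK.
have uniq a : cdom D a -> H 0 a = 0 -> H n.+1 a = 0 -> N a.2 /\ a = s a.2.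
  move=> Da Ha0 Han.
  have Phia : D a = (0, a.2).
    by rewrite DE; congr (_, _); apply/rowP => i; rewrite !mxE; case: ifP.
  split; first by rewrite /N/= /i0 -Phia; exact: cmap_img.
  by rewrite /s /i0 -Phia cmapK.
pose F p : 'rV[R]_n := \row_(i < n) H i.+1 (s p).
have sF : smooth_on N F.
  apply: smooth_on_rV => // i k.
  apply: Ck_on_ext (Ck_on_comp K oN oU Us (sN k) (sH i.+1 k)) => // p _.
  by rewrite mxE.
have dF_surj w : exists q, 'd F p0 q = w.
  (* The target w padded by zeros in the two positions used to define s. *)
  pose w' : 'rV[R]_n.+2 :=
    \row_j (if j == ord0 then 0 else oapp (w 0) 0 (insub j.-1 : option 'I_n)).
  have [v Jv] := dJ_surj w'.
  have dJa0 : differentiable J a0 by exact: smooth_on_differentiable sJ Ua0.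
  have Hv (j : 'I_n.+2) : 'd (H j) a0 v = w' 0 j.
    rewrite -Jv (diff_coord _ _ _ dJa0).
    suff -> : (fun a => J a 0 j : R^o) = H j by [].
    by apply/funext => a; rewrite mxE.
  have ds : differentiable s p0 by exact: smooth_on_differentiable sN Np0.
  have dsa q : 'd Phi a0 ('d s p0 q) = (0, q).
    have dPhis : differentiable Phi (s p0).
      by rewrite sp0; exact: smooth_on_differentiable sPhi Ua0.
    have := diff_comp ds dPhis; rewrite sp0 => /(congr1 (fun L => L q)) /= <-.
    have di0 : differentiable i0 p0 by exact: differentiable_pair.
    rewrite (@near_eq_diff _ _ _ i0)//.
      by rewrite /i0 diff_pair//= diff_cst diff_val.
    by near=> p; rewrite /= Phis//; near: p; exact: open_nbhs_nbhs.
  (* A vector on which the differentials of H 0 and H n.+1 vanish is tangent to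
     the graph, hence determined by its parameter component. *)
  have vs : v = 'd s p0 v.2.
    apply/eqP; rewrite -subr_eq0; apply/eqP/dPhi_inj; rewrite linearB dsa.
    apply/eqP; rewrite subr_eq0; apply/eqP; rewrite dPhi; congr (_, _).
    apply/rowP => i; rewrite !mxE; case: ifP => _.
      by rewrite (Hv ord0) mxE.
    rewrite (Hv ord_max) mxE/= insubF ?ltnn//.
  exists v.2; apply/rowP => i; rewrite diff_coord; last first.
    exact: smooth_on_differentiable sF Np0.
  have -> : (fun p => F p 0 i : R^o) = H i.+1 \o s.
    by apply/funext => p; rewrite mxE.
  have dHs : differentiable (H i.+1) (s p0) by rewrite sp0; exact: dH.
  rewrite (diff_comp ds dHs) /= sp0 -vs.
  have i1 : (i.+1 < n.+2)%N by rewrite ltnS ltnW// ltnS.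
  by rewrite (Hv (Ordinal i1)) mxE /= valK.
have [l [dJ [ddJ dJa0 dJU dJE]]] := submersion_chart K oU Ua0 sJ dJ_surj.
have [l' [dF [ddF dFp0 dFN dFE]]] :=
  submersion_chart (rV_coords R m) oN Np0 sF dF_surj.
have oF := cdom_open dF.
pose V := cdom D `&` cdom dJ `&` (U `&` H n.+2 @^-1` [set x | x != 0]) `&`
  (snd @^-1` cdom dF).
exists V, (fun p => (s p).1), l, dJ, l', dF; split.
- split.
  + apply: openI; first apply: openI; first by apply: openI; exact: cdom_open.
      apply: open_preimage_on => //.
      by move=> a Ua; exact: smooth_on_continuous (sH n.+2) Ua.
    by apply: open_comp => // a _; exact: cvg_snd.
  + by split.
  + by move=> a [[_ []]].
  + by move=> a [[_ []]].
- by split=> // a [[[]]].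
- split=> //.
  + by move=> a [].
  + have sNF : smooth_on (cdom dF) s by exact: smooth_on_sub sN.
    by apply: (@smooth_on_linear_comp _ _ _ _ _ fst) => // a; exact: cvg_fst.
  + move=> p /dFN Np; rewrite -sE//; split; first exact: Us.
    rewrite dFE; split=> [Fp|Jp]; apply/rowP => i; rewrite !mxE.
      case: i => -[|i] /= ip; first exact: Hs0.
      have [iltn|] := ltnP i n.
        by have /rowP/(_ (Ordinal iltn)) := Fp; rewrite !mxE.
      move=> ni; rewrite (_ : i = n) ?Hsn//.
      by apply/eqP; rewrite eqn_leq ni andbT -ltnS.
    have iltn : (i.+1 < n.+2)%N by rewrite ltnS ltnW// ltnS.
    by have /rowP/(_ (Ordinal iltn)) := Jp; rewrite !mxE.
- move=> a [[[Da _] _] _] Ja.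
  have Ha (i : 'I_n.+2) : H i a = 0 by have /rowP/(_ i) := Ja; rewrite !mxE.
  by have [_ <-] := uniq a Da (Ha ord0) (Ha ord_max).
Unshelve. all: by end_near. Qed.

End LocalModel.

(** * Maps into the surface given in a chart, and graphs *)

Lemma msmooth_local_param (R : realType) (T : topologicalType)
    (E F : normedModType R) n (k : coords E n) (A : smooth_atlas T E) (z0 : T)
    (N : set F) (theta : F -> E) :
  open N -> smooth_on N theta ->
  (forall p, N p -> cimg (chart_at A z0) (theta p)) ->
  msmooth_on (vec_atlas F) A N (cinv (chart_at A z0) \o theta).
Proof.
move=> oN sth cth.
have cc p : N p -> {for p, continuous (cinv (chart_at A z0) \o theta)}.
  move=> Np; apply: continuous_comp; first exact: smooth_on_continuous sth Np.
  exact/cinv_cont/cth.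
split=> // x y.
have oV : open (cimg (chart_at A z0) `&`
    cinv (chart_at A z0) @^-1` cdom (chart_at A y)).
  apply: open_preimage_on;
    [exact: cimg_open|exact: cdom_open|exact: cinv_cont].
set U := (X in smooth_on X _).
have UE : U = N `&` (cinv (chart_at A z0) \o theta) @^-1` cdom (chart_at A y).
  by apply/seteqP; split=> e /=; [case|case].
have oU : open U.
  by rewrite UE; apply: open_preimage_on => //; exact: cdom_open.
apply: (@smooth_on_comp _ _ _ _ _ k U _
  (chart_at A y \o cinv (chart_at A z0)) theta oU oV).
- by rewrite UE => p [Np /= ?]; split=> //; exact: cth.
- by apply: smooth_on_sub sth; rewrite UE => p [].
- exact: chart_at_compat.
Qed.

Section Graphs.
Context (R : realType) (M : smooth_surface R) (m : nat).
Let A := surf_atlas M.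

(** A curve in a graph is recovered from its projection, so its velocity is
    recovered from the velocity of the projection by the derivative of the
    parametrization.  This makes the projection of a graph an immersion. *)
Lemma tangent_set_graph (N : set 'rV[R]_m) (zeta : 'rV[R]_m -> M)
    (S : set (M * 'rV[R]_m)) x v :
  msmooth_on (vec_atlas 'rV[R]_m) A N zeta ->
  (forall z p, S (z, p) -> N p /\ z = zeta p) ->
  tangent_set (total_atlas M m) S x v ->
  v = 'd (fun p => (chart_at A x.1 (zeta p), p)) (x.2) v.2.
Proof.
move=> [zc zs] Sgraph [e [gamma [e0 [gc gs] gx gS gv]]].
set C := chart_at (total_atlas M m) x.
pose f : R^o -> 'rV[R]_2 * 'rV[R]_m := C \o gamma.
have i0 : `]-e, e[%classic (0 : R) by rewrite /= in_itv/= oppr_lt0 e0.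
have df : differentiable f (0 : R^o).
  have := gs 0 x => /(smooth_on_differentiable (x := 0)); apply; split=> //.
  suff : cdom C (gamma 0) by [].
  by rewrite gx; exact: chart_at_mem.
have gvE : v = 'd f (0 : R^o) 1 by rewrite -gv /mdiff gx.
have Sx : S (x.1, x.2) by rewrite -surjective_pairing -gx; exact: gS.
have [Nx xE] := Sgraph _ _ Sx.
pose g p := (chart_at A x.1 (zeta p), p).
have f0 : (snd \o f) 0 = x.2 by rewrite /f/= gx.
have dz : differentiable (fun p => chart_at A x.1 (zeta p)) (x.2).
  have := zs x.2 x.1 => /(smooth_on_differentiable (x := x.2)).
  apply; split=> //=.
  by rewrite -xE; exact: chart_at_mem.
have dg : differentiable g (x.2) by exact: differentiable_pair.
have dsnd a : differentiable (snd : 'rV[R]_2 * 'rV[R]_m -> 'rV[R]_m) a.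
  by apply: (linear_differentiable (f := snd)) => b; exact: cvg_snd.
have dq : differentiable (snd \o f) (0 : R^o) by exact: differentiable_comp.
have dqE : 'd (snd \o f) (0 : R^o) 1 = v.2.
  by rewrite (diff_linear_comp (L := snd)) -?gvE// => a; exact: cvg_snd.
have dgq : differentiable g ((snd \o f) 0) by rewrite f0.
rewrite -/g -dqE [LHS]gvE.
have -> : 'd g (x.2) ('d (snd \o f) (0 : R^o) 1) =
    'd (g \o (snd \o f)) (0 : R^o) 1.
  by rewrite (diff_comp dq dgq) -f0.
apply: near_eq_diff; last exact: differentiable_comp.
near=> t.
have it : `]-e, e[%classic (t : R).
  near: t; apply: open_nbhs_nbhs; split=> //; exact: interval_open.
have := gS _ it; rewrite /f/g/=; case: (gamma t) => z p /= /Sgraph[_ ->].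
by [].
Unshelve. all: by end_near. Qed.

End Graphs.

(** * Persistence and codimension of order-nu contacts *)

Unset Implicit Arguments.

Theorem theorem5p2 (R : realType) (M : smooth_surface R) (m : nat)
    (P : set 'rV[R]_m) (X : 'rV[R]_m -> M -> 'rV[R]_2)
    (h : 'rV[R]_m -> M -> R^o) (nu : nat) (z0 : M) (p0 : 'rV[R]_m) :
  open P -> smooth_field_family X P -> smooth_function_family h P ->
  (2 <= nu)%N -> ~~ odd nu -> P p0 -> transverse_contact X h nu z0 p0 ->
  exists W0 : set (M * 'rV[R]_m),
    [/\ open W0, W0 (z0, p0) &
    forall W : set (M * 'rV[R]_m), open W -> W (z0, p0) -> W `<=` W0 ->
    let I := incidence X h P nu `&` W in
    let G := snd @` I in
    [/\ submanifold (total_atlas M m) I nu,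
        embedding_on (total_atlas M m) (vec_atlas 'rV[R]_m) I snd,
        submanifold (vec_atlas 'rV[R]_m) G (nu - 2)%N &
        exists zeta : 'rV[R]_m -> M,
          [/\ forall p, G p -> contact_of_order X h nu (zeta p, p),
              forall p, G p -> forall z, I (z, p) <-> z = zeta p &
              msmooth_subset (vec_atlas 'rV[R]_m) (surf_atlas M) G zeta]]].
Proof.
move=> oP sX sh nu2 _ Pp0 tc.
case: nu nu2 tc => [//|[//|n]] _ tc; rewrite !subSS subn0.
have [V [theta [l [dJ [l' [dF
    [[oV Va0 VU Hn] [ddJ VJ dJE] [ddF VF sth thE] uniq]]]]]]] :=
  local_contact_model oP sX sh Pp0 tc.
set A := surf_atlas M in Va0 VU thE *.
set c := chart_at A z0 in Va0 VU thE *.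
pose C := chart_at (total_atlas M m) (z0, p0).
have contact_repE k z p : cdom c z ->
    contact_rep X h z0 k (c z, p) = contact_fun X h k (z, p).
  by move=> cz; rewrite /contact_rep/= cmapK.
have jetE z p : cdom c z ->
    \row_(i < n.+2) contact_rep X h z0 i (c z, p) = contact_jet X h n.+2 (z, p).
  by move=> cz; apply/rowP => i; rewrite !mxE contact_repE.
pose W0 := cdom C `&` C @^-1` V.
exists W0; split.
- by apply: open_preimage_on; [exact: cdom_open|exact: oV|exact: cmap_cont].
- by split; [exact: chart_at_mem|exact: Va0].
move=> W oW Wa0 WW0 I G.
have Wc z p : W (z, p) -> cdom c z /\ V (c z, p).
  by move=> /WW0[[/= cz _] Vz].
pose zeta p := cinv c (theta p).
have oF := cdom_open dF.
have szeta : msmooth_on (vec_atlas 'rV[R]_m) A (cdom dF) zeta.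
  apply: (msmooth_local_param (rV_coords R 2)) => // p Fp.
  by have [[]] := thE p Fp.
have [czeta _] := szeta.
have domzeta p : cdom dF p -> cdom c (zeta p) /\ c (zeta p) = theta p.
  by move=> /thE[[/= cp _] _]; split; [exact: cinv_dom|exact: cinvK].
have Igraph z p : I (z, p) -> [/\ cdom dF p, z = zeta p & (dF p).1 = 0].
  move=> [[Pp Jz] Wz]; have [cz Vz] := Wc z p Wz.
  have Fp : cdom dF p by exact: VF Vz.
  have Jc : \row_(i < n.+2) contact_rep X h z0 i (c z, p) = 0 by rewrite jetE.
  have cth : c z = theta p by exact: uniq _ Vz Jc.
  split=> //; first by rewrite /zeta -cth cmapK.
  by have [_ [_]] := thE p Fp; apply; rewrite -cth.
have graphI p : cdom dF p -> (dF p).1 = 0 -> W (zeta p, p) -> I (zeta p, p).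
  move=> Fp F0 Wp; have [[_ Pp] [/(_ F0) J0 _]] := thE p Fp.
  have [czp cE] := domzeta p Fp.
  by split=> //; split=> //; rewrite -jetE// cE.
pose s p := (zeta p, p).
have cs p : cdom dF p -> {for p, continuous s}.
  by move=> Fp; exact: (cvg_pair (czeta p Fp) cvg_id).
have oN (O : set (M * 'rV[R]_m)) : open O -> open (cdom dF `&` s @^-1` O).
  by move=> oO; apply: open_preimage_on.
have GE p : G p <-> [/\ cdom dF p, W (zeta p, p) & (dF p).1 = 0].
  split=> [[[z q] Izq /= <-]|[Fp Wp F0]].
    have [Fq zq F0] := Igraph z q Izq; split=> //.
    by rewrite -zq; case: Izq.
  by exists (zeta p, p) => //; exact: graphI.
have GI p : G p -> I (zeta p, p) by move=> /GE[Fp Wp F0]; exact: graphI.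
split.
- move=> [z p] Izp.
  exists l, (restrict_chart (comp_chart C dJ) oW).
  have Wzp : W (z, p) by case: Izp.
  split.
  + apply: smooth_chart_restrict.
    have K := prod_coords (rV_coords R 2) (rV_coords R m).
    exact: smooth_chart_comp K _ _ _ ddJ.
  + by have [Cz Vz] := WW0 _ Wzp; split=> //; split=> //; exact: VJ.
  + apply/seteqP; split=> -[z' p'] /=.
      move=> [[[Pp' Jz'] Wz'] D]; split=> //.
      have [cz' _] := Wc _ _ Wz'.
      by rewrite dJE jetE.
    move=> [[D Wz'] J'].
    have [cz' Vz'] := Wc _ _ Wz'.
    split=> //; split=> //; split; first by have [] := VU _ Vz'.
    by rewrite -jetE// -dJE.
- split.
  + exists setT; split; [exact: openT|exact: subsetT|].
    split=> [x _|x y]; first exact: cvg_snd.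
    apply: (@smooth_on_linear _ _ _ _ snd) => a; exact: cvg_snd.
  + move=> x Ix v w; rewrite !inE => tv tw.
    have sndE u : mdiff (total_atlas M m) (vec_atlas 'rV[R]_m) snd x u = u.2.
      by rewrite /mdiff (diff_lin (f := snd)) // => a; exact: cvg_snd.
    have Sg z p : I (z, p) -> cdom dF p /\ z = zeta p by move=> /Igraph[].
    rewrite !sndE => vw.
    rewrite (tangent_set_graph szeta Sg tv).
    by rewrite (tangent_set_graph szeta Sg tw) vw.
  + move=> [z p] [z' p'] /[!inE] /Igraph[_ -> _] /Igraph[_ -> _] /= <-.
    by [].
  + move=> O oO; exists (cdom dF `&` s @^-1` O); split; first exact: oN.
    apply/seteqP; split=> p.
      move=> [[z q] [Izq Oz] /= <-]; split; first by exists (z, q).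
      by have [Fq zq _] := Igraph z q Izq; split=> //; rewrite /s/= -zq.
    move=> [Gp [Fp Op]]; exists (zeta p, p) => //; split=> //; exact: GI.
- move=> p Gp; have [Fp Wp F0] := (GE p).1 Gp.
  have oNW := oN W oW.
  exists l', (restrict_chart dF oNW); split.
  + by apply: smooth_chart_restrict; exact: smooth_chart_vec.
  + by split.
  + apply/seteqP; split=> q /=.
      by move=> [/GE[Fq Wq dq] ?].
    by move=> [[Fq [_ Wq]] dq]; split=> //; apply/GE.
- exists zeta; split.
  + move=> p /GI[[_ Jp] Wp]; split=> //.
    have [cz Vz] := Wc _ _ Wp.
    by apply/eqP; rewrite -contact_repE//; exact: Hn.
  + move=> p Gp z; split=> [/Igraph[]//|->]; exact: GI.
  + by move=> p /GE[Fp _ _]; exists (cdom dF), zeta; split.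
Qed.
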